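(* Let $S$ be a primitive origami with $N_S$ squares, let $M_S:=\max_{p/q\in\mathbb Q}m(p/q;S)$, and let $\alpha=[a_1,a_2,\dots]\in(0,1)$ be an irrational slope such that $$L(\mathbb T^2,\alpha)>M_S^2-2.$$ Then $$L(S,\alpha)=N_S\cdot\limsup_{n\to\infty}\ \max_{1\le i\le a_n}\ \frac{D(n,i,\alpha)}{m^2\big(\infty;R\cdot g(a_1,\dots,a_{n-1},i)\cdot S\big)}.$$
   Context: Continued fractions: $[a_1,a_2,\dots]:=\cfrac{1}{a_1+\cfrac{1}{a_2+\cdots}}$, and similarly for finite expansions. For $\alpha=[a_1,a_2,\dots]$, $n\ge1$ and $1\le i\le a_n$ define $$D(n,a_n,\alpha):=[a_n,a_{n-1},\dots,a_1]+a_{n+1}+[a_{n+2},a_{n+3},\dots],$$ $$D(n,i,\alpha):=[i,a_{n-1},\dots,a_1]+[a_n-i,a_{n+1},a_{n+2},\dots]\quad\text{if }1\le i<a_n.$$ Let $T=\begin{pmatrix}1&1\\0&1\end{pmatrix}$, $R=\begin{pmatrix}0&-1\\1&0\end{pmatrix}$, and for positive integers $a_1,\dots,a_n$ let $$g(a_1,\dots,a_n):=(T^{\epsilon_na_n}R)\cdots(T^{-a_2}R)(T^{a_1}R),\qquad \epsilon_k=+1\text{ for }k\text{ odd},\ \epsilon_k=-1\text{ for }k\text{ even}.$$ Translation surfaces: $S=(M,w)$ is a compact Riemann surface with a nonzero holomorphic 1-form; $\mathrm{SL}(2,\mathbb R)$ acts by post-composition with $w$. $\mathrm{Hol}(S)$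 is the set of periods $\int_\gamma w$ of saddle connections $\gamma$; $\mathrm{Sys}(S):=\min_{v\in\mathrm{Hol}(S)}|v|$. With $g_t=\mathrm{diag}(e^t,e^{-t})$ and $r_\theta=\begin{pmatrix}\cos\theta&-\sin\theta\\ \sin\theta&\cos\theta\end{pmatrix}$, set $L(S):=\limsup_{t\to+\infty}2/\mathrm{Sys}(g_t\cdot S)^2$ (which equals $\limsup_{|\mathrm{Im}\,v|\to\infty}\frac{1}{|\mathrm{Re}\,v||\mathrm{Im}\,v|}$ over periods $v$ if there is no vertical saddle connection) and $L(S,\alpha):=L(r_{\arctan\alpha}\cdot S)$, where surfaces are normalized to area 1 (an origami with $N$ unit squares is rescaled to area 1 when computing $L$). For the torus, $L(\mathbb T^2,\alpha)=\limsup_{q,p\to\infty}\frac{1}{q|q\alpha-p|}$. Origamis: an origami $S$ is a translation surface tiled by copies of $[0,1]^2$, i.e. with a covering $\rho:S\to\mathbb T^2=\mathbb R^2/\mathbb Z^2$ unramified outside $0$ with 1-form $\rho^*(dz)$. It is primitive if its periods generate $\mathbb Z^2$. $\mathrm{SL}(2,\mathbb Z)$ acts on primitive origamis with a given number of squares. The multiplicity $m(\gamma)$ of a saddle connection $\gamma$ of $S$ is the degree of $\rho\circ\gamma$ onto its image closed geodesic in $\mathbb T^2$ (so its period is $\pm m(\gamma)(p+iq)$ with $p,q$ coprime). For $p/q\in\mathbb Q\cup\{\infty\}$ (lowest terms, $\infty=1/0$ being the horizontal direction), $m(p/q;S)$ is the minimum of $m(\gamma)$ over saddle connections $\gamma$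 of $S$ with period parallel to $p+iq$. *)

(* Defs.v *)
From Stdlib Require Import Relation_Operators.
From HB Require Import structures.
From mathcomp Require Import all_boot all_order all_fingroup all_algebra.
From mathcomp Require Import finmap.
From mathcomp Require Import all_classical all_reals all_analysis.
Set Implicit Arguments.
Unset Strict Implicit.
Unset Printing Implicit Defensive.
Import Order.TTheory GRing.Theory Num.Theory.
Import numFieldNormedType.Exports.
Local Open Scope classical_set_scope.
Local Open Scope ring_scope.

(* [dflt] is returned only when the set has no least (greatest) element. *)
Definition minimum {d} {T : porderType d} (dflt : T) (A : set T) : T :=
  xget dflt (A `&` lbound A).
Definition maximum {d} {T : porderType d} (dflt : T) (A : set T) : T :=
  xget dflt (A `&` ubound A).

(* cf [:: a_1; ...; a_n] = [a_1, ..., a_n] = 1/(a_1 + 1/(a_2 + ...)). *)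
Definition cf {R : realType} (s : seq nat) : R :=
  foldr (fun k x => (k%:R + x)^-1) 0 s.
(* cf_inf b = [b 0, b 1, ...]. *)
Definition cf_inf {R : realType} (b : nat -> nat) : R :=
  lim ((fun n => cf (mkseq b n) : R) @ \oo).

(* The partial quotients are a 1, a 2, ...; the value a 0 is never meant. *)
Definition cf_D {R : realType} (a : nat -> nat) (n i : nat) : R :=
  if i == a n then
    cf (rev [seq a k | k <- iota 1 n]) + (a n.+1)%:R
    + cf_inf (fun k => a (n.+2 + k)%N)
  else
    cf (i :: rev [seq a k | k <- iota 1 n.-1])
    + cf_inf (fun k => if k == 0%N then (a n - i)%N else a (n + k)%N).

(* Vectors x + iy are written as columns (x, y). *)
Definition vec2 {R : realType} (x y : R) : 'cV[R]_2 :=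
  \col_i (if i == 0 then x else y).
Definition mx2 {R : realType} (a b c d : R) : 'M[R]_2 :=
  \matrix_(i, j) (if i == 0 then (if j == 0 then a else b)
                  else (if j == 0 then c else d)).
Definition norm2 {R : realType} (w : 'cV[R]_2) : R :=
  Num.sqrt (w 0 0 ^+ 2 + w 1 0 ^+ 2).

Definition mxT {R : realType} : 'M[R]_2 := mx2 1 1 0 1.
Definition mxR {R : realType} : 'M[R]_2 := mx2 0 (-1) 1 0.
Definition mx_gt {R : realType} (t : R) : 'M[R]_2 :=
  mx2 (expR t) 0 0 (expR (- t)).
Definition mx_rot {R : realType} (x : R) : 'M[R]_2 :=
  mx2 (cos x) (- sin x) (sin x) (cos x).

(* The letter a_j is s`_(j-1), so its sign is (-1)^(j-1); the factor of the
   last letter is the leftmost one. *)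
Definition cf_g {R : realType} (s : seq nat) : 'M[R]_2 :=
  \prod_(k <- rev (iota 0 (size s)))
     (mxT ^ ((-1) ^+ k * (nth 0%N s k)%:Z)%R * mxR).

(* A connected surface glued from finitely many copies of the unit square:
   the right side of s is glued to the left side of [hperm s], the top side of
   s to the bottom side of [vperm s]. *)
Record origami := Origami {
  sq : finType;
  hperm : {perm sq};
  vperm : {perm sq};
  sq_connected : [transitive <[hperm]> <*> <[vperm]>, on [set: sq]%SET | 'P]%g }.

Lemma torus_connected :
  [transitive <[1 : {perm unit}]> <*> <[1]>, on [set: unit]%SET | 'P]%g.
Proof.
apply/imsetP; exists tt; rewrite ?inE //.
by apply/setP => -[]; rewrite inE (orbit_refl 'P%act).
Qed.
Definition torus : origami := Origami torus_connected.

(* The surfaces of the GL(2, R)-orbits of origamis: the squares [0,1]^2 are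
   replaced by the parallelograms [frame [0,1]^2], with the same gluing.
   Post-composing the form w with a matrix multiplies the frame on the left.
   [frame] is meant to be invertible. *)
Record tsurface (R : realType) := TSurface {
  base : origami;
  frame : 'M[R]_2 }.

Definition gl_act {R : realType} (A : 'M[R]_2) (S : tsurface R) : tsurface R :=
  TSurface (base S) (A *m frame S).
Definition surf (R : realType) (O : origami) : tsurface R := TSurface O 1%:M.
Definition area {R : realType} (S : tsurface R) : R :=
  #|sq (base S)|%:R * `|\det (frame S)|.
Definition normalize {R : realType} (S : tsurface R) : tsurface R :=
  TSurface (base S) ((Num.sqrt (area S))^-1 *: frame S).

Section Geometry.
Variables (R : realType) (O : origami).

(* A point of a tile, in the coordinates of [0,1]^2. *)
Definition tile_pt := (sq O * 'cV[R]_2)%type.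
Definition in_tile (x : tile_pt) := forall i, 0 <= x.2 i 0 <= 1.

Inductive side_glue : tile_pt -> tile_pt -> Prop :=
| side_right s y : 0 <= y <= 1 ->
    side_glue (s, vec2 1 y) (hperm O s, vec2 0 y)
| side_top s x : 0 <= x <= 1 ->
    side_glue (s, vec2 x 1) (vperm O s, vec2 x 0).
Definition same_point : tile_pt -> tile_pt -> Prop :=
  clos_refl_sym_trans tile_pt side_glue.

(* The number of tiles whose lower left corner is x. Around a vertex the four
   kinds of corners alternate, and one of each kind makes an angle 2 pi: the
   cone angle at a vertex x is 2 pi * cone_order x. Off the vertices
   cone_order x = 0. *)
Definition cone_order (x : tile_pt) : nat :=
  #|[pred s : sq O | `[< same_point (s, 0) x >]]|.

(* The endpoints of saddle connections: the zeros of w, and on the torus R^2/Z^2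
   (where w has no zero) the marked point 0. Vertices of cone angle 2 pi on an
   origami with at least two squares are ordinary points. *)
Definition singular (x : tile_pt) : Prop :=
  (1 < cone_order x)%N \/ (#|sq O| = 1%N /\ (0 < cone_order x)%N).

(* traj A w x t y: moving from x with constant velocity w for a time t, in the
   surface with frame A, leads to y, with no singular point strictly between. *)
Inductive traj (A : 'M[R]_2) (w : 'cV[R]_2) : tile_pt -> R -> tile_pt -> Prop :=
| traj_tile s P Q t : in_tile (s, P) -> in_tile (s, Q) -> 0 < t ->
    A *m (Q - P) = t *: w -> traj A w (s, P) t (s, Q)
| traj_cat x t y y' t' z : traj A w x t y -> same_point y y' ->
    ~ singular y -> traj A w y' t' z -> traj A w x (t + t') z.

End Geometry.

Section Invariants.
Variable R : realType.
Implicit Types (S : tsurface R) (w : 'cV[R]_2).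

(* The periods of the saddle connections; a saddle connection is parametrized
   by [0, 1], so that its velocity is its period. *)
Definition Hol S : set 'cV[R]_2 :=
  [set w | w != 0 /\ exists x y : tile_pt R (base S),
     [/\ singular x, singular y & traj (frame S) w x 1 y]].

Definition Sys S : R := minimum 0 (@norm2 R @` Hol S).

Definition Lag S : \bar R :=
  limf_esup (fun t : R => (2 / Sys (gl_act (mx_gt t) (normalize S)) ^+ 2)%:E)
    (pinfty_nbhs R).
Definition Lag_slope S (alpha : R) : \bar R :=
  Lag (gl_act (mx_rot (atan alpha)) S).

Definition Z2 : set 'cV[R]_2 :=
  [set w | w 0 0 \is a Num.int /\ w 1 0 \is a Num.int].
Definition additive_subgroup (G : set 'cV[R]_2) : Prop :=
  G 0 /\ forall u v, G u -> G v -> G (u - v).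
Definition primitive (O : origami) : Prop :=
  smallest additive_subgroup (Hol (surf R O)) = Z2.

(* The multiplicity m(gamma) of a saddle connection gamma : [0,1] -> S of period
   w in Z^2: rho (gamma t) = t w mod Z^2, with rho the integral of the form
   mod Z^2, and the degree of this closed geodesic onto its image is the number
   of its passages at 0. *)
Definition multiplicity w : nat :=
  #|` fset_set [set t : R | 0 <= t < 1 /\ Z2 (t *: w)]|.

(* m(p/q; S), the minimum being over the saddle connections parallel to
   p + iq. *)
Definition mult_dir (p q : int) S : nat :=
  minimum 0%N (multiplicity @`
    (Hol S `&` [set w | exists c : R, w = c *: vec2 p%:~R q%:~R])).
Definition mult_rat (r : rat) S : nat := mult_dir (numq r) (denq r) S.
Definition mult_infty S : nat := mult_dir 1 0 S.

Definition max_mult (O : origami) : nat :=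
  maximum 0%N (range (fun r => mult_rat r (surf R O))).

End Invariants.

(* Main.v *)
From Stdlib Require Import Relation_Operators.
Require Import Defs.
From HB Require Import structures.
From mathcomp Require Import all_boot all_order all_fingroup all_algebra.
From mathcomp Require Import finmap.
From mathcomp Require Import all_classical all_reals all_analysis.
From mathcomp Require Import zify ring lra.
Set Implicit Arguments.
Unset Strict Implicit.
Unset Printing Implicit Defensive.
Import Order.TTheory GRing.Theory Num.Theory.
Import numFieldNormedType.Exports.
Local Open Scope classical_set_scope.
Local Open Scope ring_scope.

(* Write v = m (p, q) for a period of the origami, with p, q coprime. Up to the
   rotation of slope alpha, 2 / Sys (g_t S)^2 is N times the maximum over the
   periods of 2 / ((e^t Re v)^2 + (e^-t Im v)^2), and by AM-GM the limsup of
   this maximum is that of 1 / (m^2 q |q alpha - p|).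
   If p/q = [a_1, ..., a_(n-1), i], then q |q alpha - p| = 1 / D(n, i, alpha)
   and R g(a_1, ..., a_(n-1), i) sends p + iq to the horizontal direction: these
   directions give the right-hand side lambda.
   Any other (p, q) is s v + r w with s, r >= 1, where v, w are two consecutive
   intermediate convergents forming a basis, whence
   q |q alpha - p| >= 1 + F(v) + F(w), with F(p, q) = q |q alpha - p|. If
   mu > lambda, then F(v), F(w) >= 1 / (M^2 mu) far enough, so that these
   directions contribute at most mu as soon as mu >= 1 - 2 / M^2; this last
   inequality is what L(T^2, alpha) > M^2 - 2 gives, by the same bounds on the
   torus.
   The multiplicities are positive and bounded because from a singular corner
   the straight line of direction p + iq permutes the tile corners, and so comes
   back within N steps. *)

(** * Convergence of continued fractions *)

Section ContinuedFractions.
Variable R : realType.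
Implicit Types (b : nat -> nat) (s : seq nat) (x y : R).

Local Notation cfold := (foldr (fun (k : nat) (x : R) => (k%:R + x)^-1)).

Lemma cfold_itv s x : all (leq 1) s -> 0 <= x <= 1 -> 0 <= cfold x s <= 1.
Proof.
move=> s_gt0 x01; elim: s s_gt0 => //= k s IHs /andP[k_gt0 /IHs /andP[c0 c1]].
have k1 : 1 <= k%:R :> R by rewrite ler1n.
by rewrite invr_ge0 invf_le1; lra.
Qed.

(** One letter alone need not contract: x -> 1/(1 + x) has slope -1 at 0. Over two letters the
    difference is divided by two factors, each at least 2. *)
Lemma cfold_contraction n s x y : size s = n.*2 -> all (leq 1) s ->
  0 <= x <= 1 -> 0 <= y <= 1 -> `|cfold x s - cfold y s| <= 2^-1 ^+ n.
Proof.
move=> + + x01 y01; elim: n s => [|n IHn] [|k [|l s]]//=.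
  by move=> _ _; rewrite expr0 ler_norml; lra.
move=> [sz] /and3P[k_gt0 l_gt0 s_gt0]; move: (IHn s sz s_gt0).
have /andP[] := cfold_itv s_gt0 x01; have /andP[] := cfold_itv s_gt0 y01.
move: (cfold x s) (cfold y s) => u v v0 v1 u0 u1 uv.
have k1 : 1 <= k%:R :> R by rewrite ler1n.
have l1 : 1 <= l%:R :> R by rewrite ler1n.
set K : R := k%:R in k1 *; set L : R := l%:R in l1 *.
have A2 : 2 <= K * (L + u) + 1 by nra.
have B2 : 2 <= K * (L + v) + 1 by nra.
have -> : (K + (L + u)^-1)^-1 - (K + (L + v)^-1)^-1
        = (u - v) / ((K * (L + u) + 1) * (K * (L + v) + 1)).
  by field; rewrite !lt0r_neq0 //; nra.
rewrite exprSr normrM ler_pM // normfV lef_pV2 ?posrE ?normr_gt0 //.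
  rewrite ger0_norm; nra.
by rewrite mulf_neq0// lt0r_neq0//; lra.
Qed.

Lemma cf_itv s : all (leq 1) s -> 0 <= (cf s : R) <= 1.
Proof. by move=> s_gt0; apply: cfold_itv; rewrite // lexx ler01. Qed.

Lemma all_mkseq_gt0 b n : (forall k, (0 < b k)%N) -> all (leq 1) (mkseq b n).
Proof. by move=> b_gt0; apply/allP => _ /mapP[k _ ->]; exact: b_gt0. Qed.

Lemma cf_inf_cvg b : (forall k, (0 < b k)%N) ->
  cvgn (fun n => cf (mkseq b n) : R).
Proof.
move=> b_gt0; apply: cauchy_cvg; apply: cauchy_exP => e e_gt0.
have /cvgrPdist_lt/(_ _ e_gt0)[k _ /(_ k (leqnn k))/=] :
    (GRing.exp (2^-1 : R)) @ \oo --> (0 : R).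
  by apply: cvg_expr; rewrite ger0_norm ?invr_ge0// invf_lt1 ?ltr1n.
rewrite sub0r normrN ger0_norm ?exprn_ge0 ?invr_ge0// => ke.
exists (cf (mkseq b k.*2)); exists k.*2 => // n /= kn.
rewrite -ball_normE /ball_/=; apply: le_lt_trans ke.
(* Expansions of length at least 2k share their first 2k letters, so only the value fed into the
   fold differs. *)
rewrite /cf -(subnKC kn) /mkseq iotaD map_cat foldr_cat.
apply: cfold_contraction; rewrite ?size_map ?size_iota ?lexx ?ler01//.
  exact: all_mkseq_gt0.
apply: cfold_itv; rewrite ?lexx ?ler01//.
by apply/allP => _ /mapP[i _ ->]; exact: b_gt0.
Qed.

Lemma cf_inf_ge0 b : (forall k, (0 < b k)%N) -> 0 <= cf_inf b :> R.
Proof.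
move=> b_gt0; apply: limr_ge; first exact: cf_inf_cvg.
by apply: nearW => n; have /andP[] := cf_itv (all_mkseq_gt0 n b_gt0).
Qed.

Lemma cf_infS b : (forall k, (0 < b k)%N) ->
  cf_inf b = ((b 0%N)%:R + cf_inf (b \o S))^-1 :> R.
Proof.
move=> b_gt0; have b'_gt0 k : (0 < (b \o S) k)%N by exact: b_gt0.
apply/cvg_lim => //; rewrite -(cvg_shiftS (fun n => cf (mkseq b n) : R)) /=.
have -> : (fun n => cf (mkseq b n.+1) : R)
        = fun n => ((b 0%N)%:R + cf (mkseq (b \o S) n))^-1.
  by apply/funext => n; rewrite /mkseq /= -add1n iotaDl -map_comp.
apply: cvgV; last by apply: cvgD; [exact: cvg_cst|exact: cf_inf_cvg].
by rewrite lt0r_neq0// ltr_pwDl ?cf_inf_ge0// ltr0n.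
Qed.

Lemma cf_inf_gt0 b : (forall k, (0 < b k)%N) -> 0 < cf_inf b :> R.
Proof.
move=> b_gt0; rewrite cf_infS// invr_gt0 ltr_pwDl ?ltr0n// cf_inf_ge0// => k.
exact: b_gt0.
Qed.

End ContinuedFractions.

(** * Intermediate convergents *)

(** The pair (u_n, u_(n+1)) of the recurrence u_(n+2) = a_(n+1) u_(n+1) + u_n; [a 0] is never
    read. *)
Fixpoint conv_rec (a : nat -> nat) (x0 x1 n : nat) : nat * nat :=
  if n is m.+1 then
    let u := conv_rec a x0 x1 m in (u.2, (a n * u.2 + u.1)%N)
  else (x0, x1).

(* The index is shifted by one: cnum a n / cden a n = [a_1, ..., a_(n-1)],
   starting with the formal convergents 1/0 and 0/1. *)
Definition cnum a n := (conv_rec a 1 0 n).1.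
Definition cden a n := (conv_rec a 0 1 n).1.

Lemma cnumSS a n : cnum a n.+2 = (a n.+1 * cnum a n.+1 + cnum a n)%N.
Proof. by []. Qed.

Lemma cdenSS a n : cden a n.+2 = (a n.+1 * cden a n.+1 + cden a n)%N.
Proof. by []. Qed.

(* inum a n i / iden a n i = [a_1, ..., a_n, i]. *)
Definition inum a n i := (cnum a n + i * cnum a n.+1)%N.
Definition iden a n i := (cden a n + i * cden a n.+1)%N.

Lemma inum0 a n : inum a n 0 = cnum a n. Proof. exact: addn0. Qed.
Lemma iden0 a n : iden a n 0 = cden a n. Proof. exact: addn0. Qed.
Lemma inum_last a n : inum a n (a n.+1) = cnum a n.+2. Proof. exact: addnC. Qed.
Lemma iden_last a n : iden a n (a n.+1) = cden a n.+2. Proof. exact: addnC. Qed.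

Lemma conv_det a n :
  ((cnum a n)%:Z * (cden a n.+1)%:Z - (cnum a n.+1)%:Z * (cden a n)%:Z
   = (-1) ^+ n)%R.
Proof.
elim: n => [//|n IHn].
by rewrite cnumSS cdenSS !PoszD !PoszM exprS -IHn; ring.
Qed.

Lemma inter_det a n i :
  ((inum a n i)%:Z * (cden a n.+1)%:Z - (cnum a n.+1)%:Z * (iden a n i)%:Z
   = (-1) ^+ n)%R.
Proof. by rewrite -(conv_det a n) /inum /iden !PoszD !PoszM; ring. Qed.

Lemma coprime_inter a n i : coprime (inum a n i) (iden a n i).
Proof.
have /coprimezP : exists uv : int * int,
    uv.1 * (inum a n i)%:Z + uv.2 * (iden a n i)%:Z = 1.
  exists ((-1) ^+ n * (cden a n.+1)%:Z, - ((-1) ^+ n * (cnum a n.+1)%:Z)).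
  transitivity ((-1) ^+ n * ((inum a n i)%:Z * (cden a n.+1)%:Z
      - (cnum a n.+1)%:Z * (iden a n i)%:Z)); first by rewrite /=; ring.
  by rewrite inter_det -expr2 sqrr_sign.
by rewrite coprimezE.
Qed.

Section Positivity.
Variable a : nat -> nat.
Hypothesis a_gt0 : forall n, (0 < n)%N -> (0 < a n)%N.

Lemma cden_gt0 n : (0 < cden a n.+1)%N.
Proof. by elim: n => // n IHn; rewrite cdenSS addn_gt0 muln_gt0 a_gt0 ?IHn. Qed.

Lemma iden_gt0 n i : (0 < i)%N -> (0 < iden a n i)%N.
Proof. by move=> i0; rewrite addn_gt0 muln_gt0 i0 cden_gt0 orbT. Qed.

(** The case i = 1 is the smallest, and q_n + q_(n+1) grows by at least 1 with n. *)
Lemma leq_iden n i : (0 < i)%N -> (n <= iden a n i)%N.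
Proof.
move=> i0; rewrite /iden.
suff : (n <= cden a n + cden a n.+1)%N.
  move=> h; apply: leq_trans h _; rewrite leq_add2l; exact: leq_pmull.
elim: n => // n IHn; rewrite cdenSS.
have := a_gt0 (ltn0Sn n); have := cden_gt0 n; nia.
Qed.

End Positivity.

(* Euclid's algorithm on the coordinates of p + iq in the basis formed by two
   consecutive convergents. *)
Lemma convergent_cone a p q : (forall n, (0 < n)%N -> (0 < a n)%N) ->
  coprime p q ->
  exists n, [\/ p = cnum a n /\ q = cden a n,
    exists2 i, (i < a n.+1)%N & p = inum a n i /\ q = iden a n i |
    exists i s r, [/\ (i < a n.+1)%N, (0 < s)%N, (0 < r)%N,
      p = (s * inum a n i + r * inum a n i.+1)%N &
      q = (s * iden a n i + r * iden a n i.+1)%N]].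
Proof.
move=> a_gt0 pq.
(* Invariant: (p, q) has coordinates (x, y) in the basis of the convergents n and n+1; induction on
   a bound for x + y. *)
suff: forall m n x y, (x + y <= m)%N ->
    p = (x * cnum a n + y * cnum a n.+1)%N ->
    q = (x * cden a n + y * cden a n.+1)%N ->
    exists n, [\/ p = cnum a n /\ q = cden a n,
    exists2 i, (i < a n.+1)%N & p = inum a n i /\ q = iden a n i |
    exists i s r, [/\ (i < a n.+1)%N, (0 < s)%N, (0 < r)%N,
      p = (s * inum a n i + r * inum a n i.+1)%N &
      q = (s * iden a n i + r * iden a n i.+1)%N]].
  by move/(_ _ 0%N p q (leqnn _)); apply; rewrite /cnum /cden /=; lia.
elim=> [|m IHm] n x y xym pE qE.
  move: pq; have -> : p = 0%N by rewrite pE; nia.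
  by have -> : q = 0%N by rewrite qE; nia.
case: (posnP x) => [x0|x_gt0].
  have y1 : y = 1%N.
    have /eqP : coprime p q by [].
    by rewrite pE qE x0 -muln_gcdr => /eqP; rewrite muln_eq1 => /andP[/eqP].
  by exists n.+1; apply: Or31; rewrite pE qE x0 y1 !mul0n !mul1n.
(* If y >= a_(n+1) x, the coordinates in the next basis are (y - a_(n+1) x, x), and their sum is
   smaller since x > 0. *)
have [ya|ya] := leqP (a n.+1 * x) y.
  have h : y = (y - a n.+1 * x + a n.+1 * x)%N by rewrite subnK.
  case: (posnP y) => [y0|y_gt0].
    by move: ya; rewrite y0; have := a_gt0 _ (ltn0Sn n); nia.
  apply: (IHm n.+1 (y - a n.+1 * x)%N x).
  - have := a_gt0 _ (ltn0Sn n); nia.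
  - by rewrite cnumSS pE {1}h; lia.
  - by rewrite cdenSS qE {1}h; lia.
(* Otherwise y = i x + r with i < a_(n+1) and r < x: the vector is x - r times the i-th intermediate
   convergent plus r times the next one. If r = 0, coprimality forces x = 1. *)
have iy := divn_eq y x; have rx := ltn_pmod y x_gt0.
have ia : (y %/ x < a n.+1)%N by rewrite ltn_divLR.
exists n; case: (posnP (y %% x)) => [r0|r_gt0].
  have x1 : x = 1%N.
    have : (x %| gcdn p q)%N.
      have xy : (x %| y)%N by rewrite iy r0 addn0 dvdn_mull.
      by rewrite dvdn_gcd pE qE !dvdn_add ?(dvdn_mulr _ xy) ?dvdn_mulr.
    by have /eqP-> := pq; rewrite dvdn1 => /eqP.
  apply: Or32; exists (y %/ x)%N => //.
  by rewrite /inum /iden x1 divn1 pE qE x1 !mul1n.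
apply: Or33; exists (y %/ x)%N, (x - y %% x)%N, (y %% x)%N; split => //.
- by rewrite subn_gt0.
- rewrite /inum pE {1}iy; nia.
- rewrite /iden qE {1}iy; nia.
Qed.

(** * Quality of the intermediate convergents *)

Section Errors.
Variables (R : realType) (a : nat -> nat) (alpha : R).

(** The sign makes the error positive, convergents being alternately above and below alpha. The
    first values are 1 and alpha. *)
Definition err n : R := (-1) ^+ n * ((cnum a n)%:R - (cden a n)%:R * alpha).
Definition ierr n i : R := err n - i%:R * err n.+1.

Lemma ierrE n i :
  ierr n i = (-1) ^+ n * ((inum a n i)%:R - (iden a n i)%:R * alpha).
Proof. by rewrite /ierr /err /inum /iden !natrD !natrM exprS; ring. Qed.

Lemma ierr0 n : ierr n 0 = err n. Proof. by rewrite /ierr mul0r subr0. Qed.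

Lemma ierr_last n : ierr n (a n.+1) = err n.+2.
Proof. by rewrite ierrE /err inum_last iden_last !exprS; ring. Qed.

(** This is [conv_det] with each numerator p replaced by p - q alpha, which leaves the determinant
    unchanged. *)
Lemma err_den n : (cden a n.+1)%:R * err n + (cden a n)%:R * err n.+1 = 1.
Proof.
have /(congr1 (fun z : int => z%:~R : R)) := conv_det a n.
rewrite rmorphB !rmorphM /= -!pmulrn rmorphXn /= rmorphN1 => d.
transitivity (((-1) ^+ n) ^+ 2 : R); last by rewrite sqrr_sign.
by rewrite expr2 -{2}d /err exprS; ring.
Qed.

Lemma ierr_iden n i :
  (cden a n.+1)%:R * ierr n i + (iden a n i)%:R * err n.+1 = 1.
Proof. by rewrite -[RHS](err_den n) /ierr /iden natrD natrM; ring. Qed.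

Hypothesis a_gt0 : forall n, (0 < n)%N -> (0 < a n)%N.
Hypothesis alpha_cf : alpha = cf_inf (fun k => a k.+1).

Definition tail n : R := cf_inf (fun k => a (n.+1 + k)%N).

Lemma tail_gt0 n : 0 < tail n.
Proof. by apply: cf_inf_gt0 => k; exact: a_gt0. Qed.

Lemma tailS n : tail n = ((a n.+1)%:R + tail n.+1)^-1.
Proof.
rewrite /tail cf_infS => [|k]; last exact: a_gt0.
by rewrite addn0; congr (_ + cf_inf _)^-1; apply/funext => k /=; rewrite addnS.
Qed.

(** Dividing err_(n+2) = err_n - a_(n+1) err_(n+1) by err_(n+1) gives the recursion of the tails;
    the base case is the expansion of alpha. *)
Lemma err_tail n : err n.+1 = tail n * err n.
Proof.
elim: n => [|n IHn].
  rewrite /err /tail /= expr0 expr1 /cnum /cden /= -alpha_cf; ring.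
rewrite -ierr_last /ierr IHn tailS.
by field; rewrite lt0r_neq0// ltr_wpDl ?ler0n ?tail_gt0.
Qed.

Lemma err_gt0 n : 0 < err n.
Proof.
elim: n => [|n IHn]; last by rewrite err_tail mulr_gt0 ?tail_gt0.
by rewrite /err expr0 /cnum /cden /= mul0r subr0 mul1r ltr01.
Qed.

Lemma ierr_ge n i : (i <= a n.+1)%N -> err n.+2 <= ierr n i.
Proof.
move=> ia; rewrite -ierr_last /ierr lerD2l lerN2 ler_pM2r ?err_gt0//.
by rewrite ler_nat.
Qed.

Lemma err_anti m n : (m <= n)%N -> err n <= err m.
Proof.
move=> mn; rewrite -(subnKC mn); elim: (n - m)%N => [|k IHk].
  by rewrite addn0.
apply: le_trans IHk; rewrite addnS err_tail ger_pMl ?err_gt0//.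
rewrite tailS invf_le1 ?ltr_wpDl ?ler0n ?tail_gt0//.
by rewrite ler_wpDr ?ler1n ?a_gt0// ltW ?tail_gt0.
Qed.

Lemma ierr_gt0 n i : (i <= a n.+1)%N -> 0 < ierr n i.
Proof. by move=> ia; apply: lt_le_trans (err_gt0 _) (ierr_ge ia). Qed.

(** Dividing the recurrence of the denominators by its middle term reads the partial quotients
    backwards. *)
Lemma cf_rev n :
  cf (rev [seq a k | k <- iota 1 n]) = (cden a n)%:R / (cden a n.+1)%:R :> R.
Proof.
elim: n => [|n IHn]; first by rewrite /= /cden /= mul0r.
have -> : iota 1 n.+1 = rcons (iota 1 n) n.+1.
  by rewrite -[X in iota _ X = _]addn1 iotaD cats1 add1n.
rewrite map_rcons rev_rcons /= -/(cf _) IHn cdenSS natrD natrM.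
have q0 : 0 < (cden a n.+1)%:R :> R by rewrite ltr0n cden_gt0.
have a0 : 0 < (a n.+1)%:R :> R by rewrite ltr0n a_gt0.
have h : 0 < (a n.+1)%:R * (cden a n.+1)%:R + (cden a n)%:R :> R.
  by rewrite ltr_pwDl ?mulr_gt0.
by field; rewrite !gt_eqF.
Qed.

(** Let q, e be the denominator and error of the intermediate convergent, q', e' those of the
    convergent [n.+1]. Then D = q'/q + e'/e, and q' e + q e' = 1 by [ierr_iden]. *)
Lemma cf_DE n i : (0 < i <= a n.+1)%N ->
  cf_D a n.+1 i = ((iden a n i)%:R * ierr n i)^-1.
Proof.
move=> /andP[i0 ia].
have q_gt0 : 0 < (iden a n i)%:R :> R by rewrite ltr0n iden_gt0.
have e_gt0 := ierr_gt0 ia.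
have q'_gt0 : 0 < (cden a n.+1)%:R :> R by rewrite ltr0n cden_gt0.
have e'_gt0 := err_gt0 n.+1.
transitivity ((cden a n.+1)%:R / (iden a n i)%:R + err n.+1 / ierr n i);
  last first.
  transitivity (((cden a n.+1)%:R * ierr n i + (iden a n i)%:R * err n.+1)
                / ((iden a n i)%:R * ierr n i)).
    by field; rewrite !gt_eqF.
  by rewrite ierr_iden mul1r.
(* Here e'/e = 1/(a_(n+1) - i + tail_(n+1)); for i = a_(n+1) this is 1/tail_(n+1), which is expanded
   one letter further. *)
rewrite /cf_D; case: eqP => [->|/eqP ine].
  rewrite cf_rev ierr_last iden_last -addrA; congr (_ + _).
  rewrite (err_tail n.+1) invfM mulrCA mulfV ?gt_eqF// mulr1 tailS invrK.
  by congr (_ + cf_inf _); apply/funext => k; rewrite /= addSnnS.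
congr (_ + _).
  rewrite /= -/(cf _) cf_rev /iden natrD natrM.
  have h : (cden a n)%:R + i%:R * (cden a n.+1)%:R != 0 :> R.
    by rewrite -natrM -natrD gt_eqF.
  by field; rewrite h gt_eqF.
have lt_ia : (i < a n.+1)%N by rewrite ltn_neqAle ine.
rewrite cf_infS => [|[|k]] /=; last 2 first.
- by rewrite subn_gt0.
- exact: a_gt0.
have -> : cf_inf (((fun k => if k == 0 then a n.+1 - i else a (n.+1 + k))%N) \o S)
   = tail n.+1.
  by congr cf_inf; apply/funext => k /=; rewrite addnS.
rewrite /ierr err_tail natrB// (tailS n).
have t0 := tail_gt0 n.+1; have e0 := err_gt0 n.
have : (i%:R : R) <= (a n.+1)%:R by rewrite ler_nat.
move=> ia'; have t_gt0 : 0 < (a n.+1)%:R - i%:R + tail n.+1 by lra.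
have := mulr_gt0 e0 t_gt0.
have := ler0n R i; by move=> ? ?; field; rewrite !gt_eqF//; lra.
Qed.

End Errors.

(** * Straight lines on an origami *)

Section Plane.
Variable R : realType.
Implicit Types (x y : R) (u v w : 'cV[R]_2).

Lemma vec2_0 x y : vec2 x y 0 0 = x. Proof. by rewrite mxE. Qed.
Lemma vec2_1 x y : vec2 x y 1 0 = y. Proof. by rewrite mxE. Qed.

Lemma col2P u v : u 0 0 = v 0 0 -> u 1 0 = v 1 0 -> u = v.
Proof.
move=> e0 e1; apply/matrixP => i j; rewrite [j]ord1.
by case: i => [[|[|//]] ilt]; [move: e0|move: e1];
  congr (_ = _); congr (fun_of_matrix _ _ _); apply/val_inj.
Qed.

Lemma vec2_eta w : w = vec2 (w 0 0) (w 1 0).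
Proof. by apply: col2P; rewrite ?vec2_0 ?vec2_1. Qed.

Lemma vec2B x y x' y' : vec2 x y - vec2 x' y' = vec2 (x - x') (y - y').
Proof. by apply: col2P; rewrite !mxE. Qed.

Lemma vec2Z c x y : c *: vec2 x y = vec2 (c * x) (c * y).
Proof. by apply: col2P; rewrite !mxE. Qed.

Lemma vec2_inj x y x' y' : vec2 x y = vec2 x' y' -> x = x' /\ y = y'.
Proof.
move=> e; have := congr1 (fun v : 'cV_2 => (v 0 0, v 1 0)) e.
by rewrite !vec2_0 !vec2_1 => -[].
Qed.

Lemma vec2_00 : vec2 0 0 = 0 :> 'cV[R]_2.
Proof. by apply: col2P; rewrite !mxE. Qed.

Lemma mul_mx2_vec2 a b c d x y :
  mx2 a b c d *m vec2 x y = vec2 (a * x + b * y) (c * x + d * y) :> 'cV[R]_2.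
Proof. by apply: col2P; rewrite !mxE !big_ord_recl big_ord0 !mxE /= addr0. Qed.

Lemma Z2_0 : Z2 (0 : 'cV[R]_2). Proof. by split; rewrite mxE rpred0. Qed.

Lemma Z2_sub u v : Z2 u -> Z2 v -> Z2 (u - v).
Proof. by move=> [u0 u1] [v0 v1]; split; rewrite !mxE rpredB. Qed.

Lemma Z2_opp u : Z2 u -> Z2 (- u).
Proof. by move=> u2; rewrite -[- u]sub0r; apply: Z2_sub => //; exact: Z2_0. Qed.

Lemma Z2_add u v : Z2 u -> Z2 v -> Z2 (u + v).
Proof. by move=> u2 v2; rewrite -[v]opprK; apply/Z2_sub/Z2_opp. Qed.

Lemma Z2_vec2 (p q : int) : Z2 (vec2 p%:~R q%:~R : 'cV[R]_2).
Proof. by split; rewrite ?vec2_0 ?vec2_1. Qed.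

Lemma Z2P w : Z2 w -> exists p q : int, w = vec2 p%:~R q%:~R.
Proof.
by move=> [/intrP[p p_] /intrP[q q_]]; exists p, q; rewrite [LHS]vec2_eta p_ q_.
Qed.

End Plane.

(** * Trajectories and their displacement modulo the lattice *)

Section Surface.
Variables (R : realType) (O : origami).
Implicit Types (x y : tile_pt R O) (w : 'cV[R]_2).

(** Each gluing translates the tile coordinates by an integer vector: their class mod Z^2 is the
    covering of the torus. *)
Lemma same_point_Z2 x y : same_point x y -> Z2 (y.2 - x.2).
Proof.
elim=> {x y} [x y [s t _|s t _]|x|x y _ h|x y z _ hxy _ hyz] /=.
- rewrite vec2B sub0r subrr; exact: (Z2_vec2 R (-1) 0).
- rewrite vec2B sub0r subrr; exact: (Z2_vec2 R 0 (-1)).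
- by rewrite subrr; exact: Z2_0.
- by rewrite -opprB; exact: Z2_opp.
- by rewrite -(subrKA y.2); exact: Z2_add.
Qed.

Lemma traj_Z2 w x t y : traj 1%:M w x t y -> Z2 (y.2 - x.2 - t *: w).
Proof.
elim=> {x t y} [s P Q t _ _ _|x t y y' t' z _ hxy yy' _ _ hyz] /=.
  by rewrite mul1mx => ->; rewrite subrr; exact: Z2_0.
have -> : z.2 - x.2 - (t + t') *: w
  = (y.2 - x.2 - t *: w) + (y'.2 - y.2) + (z.2 - y'.2 - t' *: w).
  by apply: col2P; rewrite !mxE; ring.
by apply: Z2_add => //; apply: Z2_add => //; exact: same_point_Z2.
Qed.

Lemma cone_order_gt0 x : (0 < cone_order x)%N ->
  exists s : sq O, same_point (s, 0) x.
Proof. rewrite /cone_order => /card_gt0P[s sx]; exists s; exact/asboolP. Qed.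

Lemma singular_cone x : singular x -> (0 < cone_order x)%N.
Proof. by case=> [/ltnW|[]]. Qed.

Lemma singular_Z2 x : singular x -> Z2 x.2.
Proof.
move=> /singular_cone/cone_order_gt0[s] /same_point_Z2 /=.
by rewrite subr0.
Qed.

Lemma cone_order_same x y : same_point x y -> cone_order x = cone_order y.
Proof.
move=> xy; apply: eq_card => s; rewrite !inE; apply: asbool_equiv_eq; split=> h.
  exact: rst_trans h xy.
exact: rst_trans h (rst_sym _ _ _ _ xy).
Qed.

Lemma singular_same x y : same_point x y -> singular x -> singular y.
Proof. by move=> /cone_order_same xy; rewrite /singular xy. Qed.

Lemma traj_scale A w x t c y : 0 < c -> traj A w x t y ->
  traj A (c *: w) x (c^-1 * t) y.
Proof.
move=> c0; elim=> {x t y} [s P Q t hP hQ t0 e|x t y y' t' z _ IH1 yy' ns _ IH2].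
  apply: traj_tile => //; first by rewrite mulr_gt0 ?invr_gt0.
  by rewrite e scalerA mulrAC mulVf ?gt_eqF// mul1r.
by rewrite mulrDr; apply: traj_cat IH1 yy' ns IH2.
Qed.

Lemma traj_frame B A w x t y : traj A w x t y -> traj (B *m A) (B *m w) x t y.
Proof.
elim=> {x t y} [s P Q t hP hQ t0 e|x t y y' t' z _ IH1 yy' ns _ IH2].
  by apply: traj_tile => //; rewrite -mulmxA e scalemxAr.
exact: traj_cat IH1 yy' ns IH2.
Qed.

End Surface.

(** * Following a segment of rational direction through the tiles *)

Section Trace.
Variables (R : realType) (O : origami) (b : bool).

(* For b = true the tiles are read from right to left, so that the directions
   of negative slope are traced as those of positive slope. *)
Definition flip_vec (x y : R) : 'cV[R]_2 := vec2 (if b then 1 - x else x) y.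
Definition flip_dir (p q : nat) : 'cV[R]_2 := vec2 ((-1) ^+ b * p%:R) q%:R.
Definition flip_perm : {perm sq O} := if b then (hperm O)^-1%g else hperm O.

Lemma flip_glue_h s y : 0 <= y <= 1 ->
  same_point (s, flip_vec 1 y) (flip_perm s, flip_vec 0 y).
Proof.
rewrite /flip_vec /flip_perm; case: b => y01; last first.
  by apply: rst_step; exact: side_right.
apply: rst_sym; rewrite subrr subr0 -{2}[s](permKV (hperm O)).
by apply: rst_step; exact: side_right.
Qed.

Lemma flip_glue_v s x : 0 <= x <= 1 ->
  same_point (s, flip_vec x 1) (vperm O s, flip_vec x 0).
Proof.
by move=> x01; apply: rst_step; apply: side_top; case: b => //; lra.
Qed.

Lemma flip_tile s x y : 0 <= x <= 1 -> 0 <= y <= 1 ->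
  in_tile (O := O) (s, flip_vec x y).
Proof.
move=> x01 y01 i /=; rewrite mxE; case: (i == 0) => //.
by case: b => //; lra.
Qed.

Lemma flip_move (p q : nat) i j t t' :
  1%:M *m (flip_vec (t' * p%:R - i) (t' * q%:R - j)
           - flip_vec (t * p%:R - i) (t * q%:R - j))
  = (t' - t) *: flip_dir p q.
Proof.
rewrite mul1mx /flip_vec /flip_dir vec2B vec2Z; congr vec2; last by ring.
by case: b; rewrite ?expr0 ?expr1; ring.
Qed.

Lemma flip_vec_Z2 x y : Z2 (flip_vec x y) ->
  x \is a Num.int /\ y \is a Num.int.
Proof.
move=> [+ +]; rewrite vec2_0 vec2_1; case: b => hx hy; split => //.
by rewrite -[x](subKr 1) rpredB// rpred1.
Qed.

Lemma div_int (m n : nat) : (0 < n)%N ->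
  (m%:R / n%:R : R) \is a Num.int -> (n %| m)%N.
Proof.
move=> n0 /intrP[k e].
have n0' : n%:R != 0 :> R by rewrite pnatr_eq0 -lt0n.
have : (m%:Z)%:~R = (k * n%:Z)%:~R :> R.
  by rewrite intrM -e -!pmulrn mulfVK.
move=> /intr_inj mk.
have : (n%:Z %| m%:Z)%Z by rewrite mk dvdz_mull.
by rewrite dvdzE.
Qed.

(** At time t the line t (p, q) is in the cell (i, j) of the unit grid. By coprimality it meets no
    lattice point strictly between the times 0 and 1, hence no singular point. Each side crossed
    acts on the tiles by a permutation, and [f] is their product; m bounds the number of lines left
    to cross. *)
Lemma flip_trace (p q : nat) : (0 < p)%N -> (0 < q)%N -> coprime p q ->
  forall m i j (t : R), (p - i + (q - j) <= m)%N -> (i < p)%N -> (j < q)%N ->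
  i%:R <= t * p%:R < i.+1%:R -> j%:R <= t * q%:R < j.+1%:R ->
  exists f : {perm sq O}, forall s,
    traj 1%:M (flip_dir p q)
      (s, flip_vec (t * p%:R - i%:R) (t * q%:R - j%:R)) (1 - t)
      (f s, flip_vec 1 1).
Proof.
move=> p0 q0 pq; elim=> [|m IHm] i j t hm ip jq /andP[ti ti'] /andP[tj tj'].
  by lia.
have p0' : 0 < p%:R :> R by rewrite ltr0n.
have q0' : 0 < q%:R :> R by rewrite ltr0n.
have eS k : k.+1%:R = k%:R + 1 :> R by rewrite -natr1.
have Px : 0 <= t * p%:R - i%:R <= 1 by move: ti'; rewrite eS; lra.
have Py : 0 <= t * q%:R - j%:R <= 1 by move: tj'; rewrite eS; lra.
have itv01 : 0 <= (1 : R) <= 1 by rewrite ler01 lexx.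
(* Compares the exit times (i+1)/p through the vertical side and (j+1)/q through the top. *)
have [lt_ij|gt_ij|eq_ij] := ltngtP (i.+1 * q)%N (j.+1 * p)%N.
- have ip' : (i.+1 < p)%N.
    rewrite -(ltn_pmul2r q0); apply: leq_trans lt_ij _.
    by rewrite mulnC leq_mul2l jq orbT.
  pose t' : R := i.+1%:R / p%:R.
  have t'p : t' * p%:R = i.+1%:R by rewrite mulfVK ?gt_eqF.
  have tt' : t < t' by rewrite ltr_pdivlMr.
  have t'q : t' * q%:R < j.+1%:R.
    by rewrite mulrAC ltr_pdivrMr// -!natrM ltr_nat.
  have t'q' : t * q%:R <= t' * q%:R by rewrite ler_pM2r// ltW.
  have [|||f hf] := IHm i.+1 j t' _ ip' jq.
  + by clear -hm ip'; lia.
  + by rewrite t'p lexx ltr_nat ltnSn.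
  + by rewrite t'q andbT (le_trans tj).
  have Qy : 0 <= t' * q%:R - j%:R <= 1 by move: t'q; rewrite eS; lra.
  exists (flip_perm * f)%g => s.
  have -> : 1 - t = (t' - t) + (1 - t') by ring.
  have := hf (flip_perm s); rewrite t'p subrr => tr.
  rewrite permM.
  apply: (traj_cat (y := (s, flip_vec 1 (t' * q%:R - j%:R)))) tr.
  + have E : flip_vec 1 (t' * q%:R - j%:R)
            = flip_vec (t' * p%:R - i%:R) (t' * q%:R - j%:R).
      by rewrite t'p eS addrAC subrr add0r.
    apply: traj_tile; [exact: flip_tile|exact: flip_tile|by rewrite subr_gt0|].
    by rewrite E; exact: flip_move.
  + exact: flip_glue_h.
  (* A singular crossing point would be a lattice point, so that p would divide i+1 < p. *)
  + move=> /singular_Z2/flip_vec_Z2[_ /= t'int].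
    have : t' * q%:R \is a Num.int.
      by rewrite -(subrK j%:R (t' * q%:R)) rpredD ?rpred_nat.
    rewrite mulrAC -natrM => /(div_int p0).
    rewrite Gauss_dvdl// => /dvdn_leq => /(_ isT).
    by rewrite leqNgt ip'.
- have jq' : (j.+1 < q)%N.
    rewrite -(ltn_pmul2r p0); apply: leq_trans gt_ij _.
    by rewrite mulnC leq_mul2l ip orbT.
  pose t' : R := j.+1%:R / q%:R.
  have t'q : t' * q%:R = j.+1%:R by rewrite mulfVK ?gt_eqF.
  have tt' : t < t' by rewrite ltr_pdivlMr.
  have t'p : t' * p%:R < i.+1%:R.
    by rewrite mulrAC ltr_pdivrMr// -!natrM ltr_nat.
  have t'p' : t * p%:R <= t' * p%:R by rewrite ler_pM2r// ltW.
  have [|||f hf] := IHm i j.+1 t' _ ip jq'.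
  + by clear -hm jq'; lia.
  + by rewrite t'p andbT (le_trans ti).
  + by rewrite t'q lexx ltr_nat ltnSn.
  have Qx : 0 <= t' * p%:R - i%:R <= 1 by move: t'p; rewrite eS; lra.
  exists (vperm O * f)%g => s.
  have -> : 1 - t = (t' - t) + (1 - t') by ring.
  have := hf (vperm O s); rewrite t'q subrr => tr.
  rewrite permM.
  apply: (traj_cat (y := (s, flip_vec (t' * p%:R - i%:R) 1))) tr.
  + have E : flip_vec (t' * p%:R - i%:R) 1
            = flip_vec (t' * p%:R - i%:R) (t' * q%:R - j%:R).
      by rewrite t'q eS [_ + 1 - _]addrAC subrr add0r.
    apply: traj_tile; [exact: flip_tile|exact: flip_tile|by rewrite subr_gt0|].
    by rewrite E; exact: flip_move.
  + exact: flip_glue_v.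
  + move=> /singular_Z2/flip_vec_Z2[/= t'int _].
    have : t' * p%:R \is a Num.int.
      by rewrite -(subrK i%:R (t' * p%:R)) rpredD ?rpred_nat.
    rewrite mulrAC -natrM => /(div_int q0).
    rewrite Gauss_dvdl 1?coprime_sym// => /dvdn_leq => /(_ isT).
    by rewrite leqNgt jq'.
(* Equal exit times mean a lattice point, so this is the last cell. *)
- have ip' : i.+1 = p.
    have : (p %| i.+1 * q)%N by rewrite eq_ij dvdn_mull.
    rewrite Gauss_dvdl// => /dvdn_leq => /(_ isT) pi.
    by apply/eqP; rewrite eqn_leq ip pi.
  have jq' : j.+1 = q.
    by apply/eqP; rewrite -(eqn_pmul2r p0) -eq_ij -ip' mulnC.
  exists 1%g => s; rewrite perm1.
  have E : flip_vec 1 1 = flip_vec (1 * p%:R - i%:R) (1 * q%:R - j%:R).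
    by rewrite !mul1r -ip' -jq' !eS ![_ + 1 - _]addrAC !subrr !add0r.
  have t1 : t < 1 by rewrite -(ltr_pM2r p0') mul1r -{2}ip'.
  apply: traj_tile; [exact: flip_tile|exact: flip_tile|by rewrite subr_gt0|].
  by rewrite E; exact: flip_move.
Qed.

End Trace.

(** * Saddle connections and multiplicities *)

(** By well-ordering, the default value of [minimum] is not returned by accident on a nonempty set
    of naturals. *)
Lemma minimum_natP (A : set nat) : A !=set0 ->
  A (minimum 0%N A) /\ (forall n, A n -> (minimum 0%N A <= n)%N).
Proof.
move=> [m Am]; have exA : exists n, `[< A n >] by exists m; apply/asboolP.
case: (ex_minnP exA) => k /asboolP Ak k_min.
have := @xgetPex _ 0%N (A `&` lbound A).
case=> [|Ax lbA]; last by split => // n /lbA; rewrite leEnat.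
exists k; split => // n An; rewrite leEnat; apply: k_min; exact/asboolP.
Qed.

Lemma maximum_natP (A : set nat) N : A !=set0 -> (forall n, A n -> (n <= N)%N) ->
  A (maximum 0%N A) /\ (forall n, A n -> (n <= maximum 0%N A)%N).
Proof.
move=> [m Am] AN; have exA : exists n, `[< A n >] by exists m; apply/asboolP.
have ubA n : `[< A n >] -> (n <= N)%N by move=> /asboolP/AN.
case: (ex_maxnP exA ubA) => k /asboolP Ak k_max.
have := @xgetPex _ 0%N (A `&` ubound A).
case=> [|Ax lbA]; last by split => // n /lbA; rewrite leEnat.
exists k; split => // n An; rewrite leEnat; apply: k_max; exact/asboolP.
Qed.

Section SaddleConnections.
Variables (R : realType) (O : origami).
Implicit Types (x y : tile_pt R O) (w : 'cV[R]_2) (S : tsurface R).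

(** The segment ends at the far corner of a tile; crossing two sides there leads to the starting
    corner of the diagonal neighbour. For p = 0 it runs along a side. *)
Lemma flip_step b (p q : nat) : (0 < q)%N -> coprime p q ->
  exists f : {perm sq O}, forall s, exists y,
    traj 1%:M (flip_dir R b p q) (s, flip_vec b 0 0) 1 y
    /\ same_point y (f s, flip_vec b 0 0).
Proof.
move=> q0 pq; have r01 (r : R) : r = 0 \/ r = 1 -> 0 <= r <= 1.
  by case=> ->; rewrite ?lexx ?ler01.
have [p0|p0] := posnP p.
  have q1 : q = 1%N by move: pq; rewrite p0 /coprime gcd0n => /eqP.
  exists (vperm O) => s; exists (s, flip_vec b 0 1); split; last first.
    by apply: flip_glue_v; apply: r01; left.
  apply: traj_tile; rewrite ?ltr01//; try by apply: flip_tile; apply: r01; auto.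
  have := flip_move b p q 0 0 (0 : R) 1.
  by rewrite !mul0r !mul1r !subr0 p0 q1.
have [||f hf] := flip_trace O b p0 q0 pq (leqnn _) p0 q0 (t := 0 : R).
- by rewrite mul0r lexx ltr01.
- by rewrite mul0r lexx ltr01.
exists (f * flip_perm O b * vperm O)%g => s.
exists (f s, flip_vec b 1 1); split.
  by have := hf s; rewrite !mul0r !subr0.
rewrite !permM; apply: rst_trans.
  by apply: flip_glue_h; apply: r01; right.
by apply: flip_glue_v; apply: r01; left.
Qed.

(** For b = true the starting corner is the lower right one, glued to the lower left corner of the
    tile on the right. *)
Lemma flip_corner b x : singular x ->
  exists s : sq O, singular (s, flip_vec b (0 : R) 0).
Proof.
move=> sx; have [s sx0] := cone_order_gt0 (singular_cone sx).
have s0 := singular_same (rst_sym _ _ _ _ sx0) sx.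
case: b; last first.
  by exists s; rewrite /flip_vec vec2_00.
exists (flip_perm O true s); apply: singular_same s0.
have := @flip_glue_h R O true s 0; rewrite {1}/flip_vec subrr vec2_00; apply.
by rewrite lexx ler01.
Qed.

(** The permutation [f] brings the singular corner back to itself after at most as many steps as
    there are squares; the first singular corner met on the way ends a saddle connection. *)
Lemma flip_saddle b (p q : nat) x : (0 < q)%N -> coprime p q -> singular x ->
  exists2 k, (0 < k <= #|sq O|)%N & Hol (surf R O) (k%:R *: flip_dir R b p q).
Proof.
move=> q0 pq /(flip_corner b)[s0 s0_sing].
have [f hf] := flip_step b q0 pq.
pose P k := (0 < k)%N && `[< singular (iter k f s0, flip_vec b (0 : R) 0) >].
have exP : P #|porbit f s0|.
  rewrite /P iter_porbit; apply/andP; split; last exact/asboolP.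
  by apply/card_gt0P; exists s0; exact: porbit_id.
case: (ex_minnP (ex_intro P _ exP)) => k /andP[k0 /asboolP k_sing] k_min.
exists k; first by rewrite k0 (leq_trans (k_min _ exP))// max_card.
have steps m : (m < k)%N -> exists y,
    traj 1%:M (flip_dir R b p q) (s0, flip_vec b 0 0) m.+1%:R y
    /\ same_point y (iter m.+1 f s0, flip_vec b 0 0).
  elim: m => [_|m IHm mk]; first by have := hf s0.
  have [y [ty yE]] := IHm (ltnW mk).
  have [z [tz zE]] := hf (iter m.+1 f s0).
  exists z; split=> //; rewrite -natr1; apply: (traj_cat ty yE _ tz).
  move=> /(singular_same yE)/asboolP sing.
  suff : P m.+1 by move/k_min; rewrite leqNgt mk.
  by rewrite /P sing.
have [|y [ty yE]] := steps k.-1; first by rewrite prednK.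
rewrite prednK// in ty yE.
have kR : 0 < k%:R :> R by rewrite ltr0n.
split.
  apply/eqP => /(congr1 (fun v : 'cV_2 => v 1 0)).
  rewrite vec2Z vec2_1 mxE => /eqP.
  by rewrite mulf_eq0 !pnatr_eq0 !gtn_eqF.
exists (s0, flip_vec b 0 0), y; split => //.
  exact: singular_same (rst_sym _ _ _ _ yE) k_sing.
by have := traj_scale kR ty; rewrite mulVf ?gt_eqF.
Qed.

Lemma saddle_dir (p : int) (q : nat) x : (0 < q)%N -> coprime `|p| q ->
  singular x ->
  exists2 k, (0 < k <= #|sq O|)%N & Hol (surf R O) (k%:R *: vec2 p%:~R q%:R).
Proof.
move=> q0 pq sx; have [k k_ hk] := flip_saddle (p < 0) q0 pq sx.
exists k => //; suff <- : flip_dir R (p < 0) `|p| q = vec2 p%:~R q%:R by [].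
by rewrite /flip_dir [in RHS](intEsign p) intrM rmorph_sign.
Qed.

Lemma Hol_Z2 w : Hol (surf R O) w -> Z2 w.
Proof.
move=> [_ [x [y [sx sy /traj_Z2]]]]; rewrite scale1r => h.
have -> : w = y.2 - x.2 - (y.2 - x.2 - w) by rewrite subKr.
by do !apply: Z2_sub => //; exact: singular_Z2.
Qed.

Lemma Hol_frame (A F : 'M[R]_2) w : A \in unitmx ->
  Hol (TSurface O (A *m F)) (A *m w) <-> Hol (TSurface O F) w.
Proof.
move=> uA; split=> -[w0 [x [y [sx sy t]]]]; split.
- by apply: contra_neq w0 => ->; rewrite mulmx0.
- exists x, y; split => //.
  by have := traj_frame (invmx A) t; rewrite /= !mulKmx.
- by apply: contra_neq w0 => Aw; rewrite -(mulKmx uA w) Aw mulmx0.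
- by exists x, y; split => //; exact: traj_frame.
Qed.

(** Without singular points [Hol] is empty and generates only 0. *)
Lemma primitive_singular : primitive R O -> exists x, singular x.
Proof.
move=> prim; apply: contrapT => nosing.
have : Z2 (vec2 1 0 : 'cV[R]_2) by exact: (Z2_vec2 R 1 0).
rewrite -prim => /(_ [set 0]) h.
suff /(congr1 (fun v : 'cV_2 => v 0 0)) : vec2 1 0 = 0 :> 'cV[R]_2.
  by rewrite vec2_0 mxE => /eqP; rewrite oner_eq0.
apply: h; split; first by split=> // u v -> ->; rewrite subrr.
by move=> w [_ [x [y [sx _ _]]]]; exfalso; apply: nosing; exists x.
Qed.

Lemma int_bezout (p q : int) (c : R) : coprimez p q ->
  c * p%:~R \is a Num.int -> c * q%:~R \is a Num.int -> c \is a Num.int.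
Proof.
move=> /coprimezP[[u v]] /= uv cp cq.
have -> : c = u%:~R * (c * p%:~R) + v%:~R * (c * q%:~R).
  rewrite !(mulrCA _ c) -mulrDr -!intrM -intrD uv mulr1 //.
by rewrite rpredD// rpredM// ?intr_int.
Qed.

(** By Bezout the passages through Z^2 occur exactly at the times i/|k| with 0 <= i < |k|. *)
Lemma multiplicity_dir (p q k : int) : coprimez p q -> k != 0 ->
  multiplicity (k%:~R *: vec2 p%:~R q%:~R : 'cV[R]_2) = `|k|%N.
Proof.
move=> pq k0; rewrite /multiplicity; set A := [set t | _].
have kR : 0 < `|k|%:R :> R by rewrite ltr0n absz_gt0.
have kE : `|k|%:R = `|k%:~R| :> R by rewrite -intr_norm -abszE.
have AE : A = (fun i : nat => i%:R / `|k|%:R : R) @` `I_`|k|.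
  apply/seteqP; split=> [t [/andP[t0 t1]]|_ [i /= ik <-]].
    rewrite scalerA vec2Z => -[]; rewrite vec2_0 vec2_1 => tp tq.
    have /intrP[z zE] := int_bezout pq tp tq.
    have zE' : t * `|k|%:R = `|z|%:R.
      by rewrite kE -[in LHS](ger0_norm t0) -normrM zE -intr_norm -abszE.
    exists `|z|%N; last by rewrite -zE' mulfK ?gt_eqF.
    by rewrite /= -(ltr_nat R) -zE' gtr_pMl.
  split; first by rewrite divr_ge0//= ltr_pdivrMr// mul1r ltr_nat.
  have -> : (i%:R / `|k|%:R) *: (k%:~R *: vec2 p%:~R q%:~R)
     = vec2 ((i%:Z * sgz k * p)%:~R) ((i%:Z * sgz k * q)%:~R) :> 'cV[R]_2.
    rewrite scalerA vec2Z; congr vec2; rewrite intrM; congr (_ * _);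
    rewrite -mulrA intrM; congr (_ * _);
    by rewrite {2}(intEsg k) intrM -[X in _ * (_ * X)]pmulrn mulrCA mulVf ?mulr1 ?gt_eqF.
  exact: Z2_vec2.
rewrite AE; apply: card_fset_set; apply: inj_card_eq => i j _ _.
move=> /(mulIf (invr_neq0 (lt0r_neq0 kR)))/eqP.
by rewrite eqr_nat => /eqP.
Qed.

Lemma Hol_dir (p q : int) c : coprimez p q ->
  Hol (surf R O) (c *: vec2 p%:~R q%:~R) -> exists2 k : int, k != 0 & c = k%:~R.
Proof.
move=> pq hol; have [+ _] := hol; have [+ +] := Hol_Z2 hol.
rewrite vec2Z vec2_0 vec2_1 => cp cq; have /intrP[k ->] := int_bezout pq cp cq.
move=> h; exists k => //; apply: contra_neq h => ->.
by rewrite !mul0r vec2_00.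
Qed.

Lemma mult_dir_le (p q k : int) : coprimez p q ->
  Hol (surf R O) (k%:~R *: vec2 p%:~R q%:~R) ->
  (mult_dir p q (surf R O) <= `|k|)%N.
Proof.
move=> pq hk; have [k' k'0 /intr_inj kk'] := Hol_dir pq hk.
rewrite -kk' in k'0.
rewrite /mult_dir; set A := (_ @` _); have Ak : A `|k|%N.
  exists (k%:~R *: vec2 p%:~R q%:~R); last exact: multiplicity_dir.
  by split => //; exists k%:~R.
by have [_ /(_ _ Ak)] := minimum_natP (ex_intro _ _ Ak).
Qed.

Lemma mult_dir_attained (p : int) (q : nat) x : (0 < q)%N -> coprime `|p| q ->
  singular x ->
  exists k : int, [/\ k != 0, `|k|%N = mult_dir p q (surf R O) &
    Hol (surf R O) (k%:~R *: vec2 p%:~R q%:R)].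
Proof.
move=> q0 pq sx; have [n /andP[n0 _] hn] := saddle_dir q0 pq sx.
have pqz : coprimez p q by rewrite coprimezE.
rewrite /mult_dir; set A := (_ @` _).
have [] := @minimum_natP A.
  exists (multiplicity (n%:R *: vec2 p%:~R q%:R : 'cV[R]_2)); eexists => //.
  by split => //; exists n%:R.
move=> [w [hw [c wE]] <-] _; rewrite wE in hw *.
have [k k0 cE] := Hol_dir pqz hw.
exists k; split => //; first by rewrite cE multiplicity_dir.
by rewrite -cE.
Qed.

Lemma mult_dir_gt0 (p : int) (q : nat) x : (0 < q)%N -> coprime `|p| q ->
  singular x -> (0 < mult_dir p q (surf R O))%N.
Proof.
by move=> q0 pq sx; have [k [k0 <- _]] := mult_dir_attained q0 pq sx; rewrite absz_gt0.
Qed.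

Lemma mult_dir_le_max (p : int) (q : nat) x : (0 < q)%N -> coprime `|p| q ->
  singular x -> (mult_dir p q (surf R O) <= max_mult R O)%N.
Proof.
move=> q0 pq sx.
(* The number of squares bounds all multiplicities, so the maximum is attained. *)
have bound r : (mult_rat r (surf R O) <= #|sq O|)%N.
  have dE : denq r = `|denq r|%N :> int by rewrite gez0_abs.
  have [||k /andP[k0 kN] hk] := @saddle_dir (numq r) `|denq r| x _ _ sx.
  - by rewrite absz_gt0 denq_neq0.
  - exact: coprime_num_den.
  apply: leq_trans kN; have := @mult_dir_le (numq r) (denq r) k.
  rewrite /mult_rat; apply; first by rewrite coprimezE coprime_num_den.
  by rewrite dE.
have [_] := @maximum_natP (range (fun r => mult_rat r (surf R O))) #|sq O|
  (ex_intro _ _ (ex_intro2 _ _ 0 I erefl))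
  (fun n '(ex_intro2 r _ e) => eq_ind _ (fun n => n <= _)%N (bound r) _ e).
apply; exists (p%:~R / q%:~R) => //.
rewrite /mult_rat coprimeq_num// coprimeq_den// gtr0_sg ?ltz_nat// mul1r.
by rewrite gt_eqF ?ltz_nat//.
Qed.

(** The matrix B maps periods bijectively to periods and c (p, q) to c (1, 0) up to sign; by
    [multiplicity_dir] both have multiplicity |c|. *)
Lemma mult_infty_act (B : 'M[R]_2) (p q : int) (e : bool) : coprimez p q ->
  B \in unitmx -> B *m vec2 p%:~R q%:~R = (-1) ^+ e *: vec2 1 0 ->
  mult_infty (gl_act B (surf R O)) = mult_dir p q (surf R O).
Proof.
move=> pq uB BE; rewrite /mult_infty /mult_dir; congr minimum.
have mE c : Hol (surf R O) (c *: vec2 p%:~R q%:~R) ->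
    multiplicity (((-1) ^+ e * c) *: vec2 1%:~R 0%:~R)
    = multiplicity (c *: vec2 p%:~R q%:~R).
  move=> /(Hol_dir pq)[k k0 ->].
  rewrite -(rmorph_sign (intmul 1)) -intrM !multiplicity_dir//.
    by rewrite abszMsign.
  by rewrite mulf_neq0 ?signr_eq0.
have BcE c : B *m (c *: vec2 p%:~R q%:~R) = ((-1) ^+ e * c) *: vec2 1%:~R 0%:~R.
  by rewrite -scalemxAr BE scalerA mulrC.
apply/seteqP; split=> [_ [w [hw [c wE]] <-]|_ [w [hw [c wE]] <-]].
  have wB : w = B *m (((-1) ^+ e * c) *: vec2 p%:~R q%:~R).
    by rewrite BcE signrMK.
  have h : Hol (surf R O) (((-1) ^+ e * c) *: vec2 p%:~R q%:~R).
    by apply/(Hol_frame _ _ uB); rewrite -wB.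
  exists (((-1) ^+ e * c) *: vec2 p%:~R q%:~R).
    by split => //; eexists.
  by rewrite -mE// -BcE wB.
exists (B *m w); last by rewrite wE BcE mE// -wE.
split; first by apply/(Hol_frame _ _ uB).
by exists ((-1) ^+ e * c); rewrite wE BcE.
Qed.

End SaddleConnections.

(** * The matrices g *)

Section Matrices.
Variable R : realType.

Lemma mx2_unit (a b c d : R) : a * d - b * c = 1 -> mx2 a b c d \in unitmx.
Proof.
move=> dt; suff: mx2 a b c d *m mx2 d (- b) (- c) a = 1%:M.
  by move/mulmx1_unit => [].
apply/matrixP => i j; rewrite !mxE !big_ord_recl big_ord0 !mxE /= addr0.
case: i j => [[|[|//]] ?] [[|[|//]] ?] /=; rewrite -?dt; ring.
Qed.

Lemma mxT_unit : (mxT : 'M[R]_2) \in unitmx.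
Proof. by apply: mx2_unit; ring. Qed.

Lemma mxR_unit : (mxR : 'M[R]_2) \in unitmx.
Proof. by apply: mx2_unit; ring. Qed.

Lemma mxT_exp (z : int) (x y : R) :
  mxT ^ z *m vec2 x y = vec2 (x + z%:~R * y) y.
Proof.
have pos (n : nat) t : mxT ^+ n *m vec2 t y = vec2 (t + n%:R * y) y.
  elim: n t => [|n IHn] t; first by rewrite expr0 mul1mx mul0r addr0.
  rewrite exprSr -[_ * _]/(_ *m _) -mulmxA mul_mx2_vec2 !mul1r mul0r add0r.
  by rewrite IHn -natr1; congr vec2; ring.
case: z => n.
- by rewrite -exprnP pos pmulrn.
- rewrite NegzE -exprnN; apply: (canLR (mulKmx _)).
    by rewrite -[_ \in _]/(mxT ^+ n.+1 \is a GRing.unit) unitrX// mxT_unit.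
  by rewrite pos pmulrn mulrNz mulNr subrK.
Qed.

Lemma mulmxR_vec2 (x y : R) : mxR *m vec2 x y = vec2 (- y) x.
Proof. by rewrite mul_mx2_vec2; congr vec2; ring. Qed.

Lemma cf_g_rcons s k : cf_g (rcons s k) =
  (mxT ^ ((-1) ^+ size s * k%:Z)%R * mxR) *m cf_g s :> 'M[R]_2.
Proof.
rewrite /cf_g size_rcons -[in iota 0 _]addn1 iotaD cats1 rev_rcons big_cons add0n.
rewrite nth_rcons ltnn eqxx; congr (_ * _).
apply: eq_big_seq => j; rewrite mem_rev mem_iota => /andP[_ js].
by rewrite nth_rcons js.
Qed.

Lemma cf_g_unit s : (cf_g s : 'M[R]_2) \in unitmx.
Proof.
elim/last_ind: s => [|s k IHs].
  by rewrite /cf_g big_nil unitmx1.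
rewrite cf_g_rcons !unitmx_mul IHs mxR_unit !andbT.
by rewrite -[_ \in _]/(mxT ^ _ \is a GRing.unit) unitrXz// mxT_unit.
Qed.

(** Up to signs, g(a_1, ..., a_n) maps the last two convergents to the standard basis. In the
    induction R exchanges the axes, and the power of T, whose sign alternates, cancels the term
    a_(n+1) of the recurrence. *)
Lemma cf_g_conv a n : exists e : bool,
  let g := cf_g [seq a k | k <- iota 1 n] : 'M[R]_2 in
  g *m vec2 (cnum a n)%:R (cden a n)%:R = (-1) ^+ e *: vec2 1 0 /\
  g *m vec2 (cnum a n.+1)%:R (cden a n.+1)%:R
    = ((-1) ^+ n * (-1) ^+ e) *: vec2 0 1.
Proof.
elim: n => [|n [e [IH0 IH1]]].
  by exists false; rewrite /= /cf_g big_nil !mul1mx !expr0 mul1r !scale1r.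
have -> : iota 1 n.+1 = rcons (iota 1 n) n.+1.
  by rewrite -[X in iota _ X = _]addn1 iotaD cats1 add1n.
set g := cf_g _ in IH0 IH1.
(* The new first vector is R applied to the old second one, hence the sign -(-1)^(n+e). *)
exists (~~ odd n (+) e); rewrite map_rcons cf_g_rcons size_map size_iota -/g /=.
split; rewrite -!mulmxA.
  rewrite IH1 vec2Z mulmxR_vec2 mxT_exp vec2Z mulr0 mulr1; congr vec2; last by ring.
  by rewrite -signr_odd; case: (odd n); case: (e) => /=; ring.
have -> : vec2 (cnum a n.+2)%:R (cden a n.+2)%:R
    = (a n.+1)%:R *: vec2 (cnum a n.+1)%:R (cden a n.+1)%:R
      + vec2 (cnum a n)%:R (cden a n)%:R :> 'cV[R]_2.
  by apply: col2P; rewrite !mxE -natrM -natrD.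
rewrite mulmxDr -scalemxAr IH1 IH0.
have -> : (a n.+1)%:R *: (((-1) ^+ n * (-1) ^+ e) *: vec2 0 1)
    + (-1) ^+ e *: vec2 1 0
  = vec2 ((-1) ^+ e) ((a n.+1)%:R * (-1) ^+ n * (-1) ^+ e) :> 'cV[R]_2.
  by apply: col2P; rewrite !mxE /=; ring.
rewrite mulmxR_vec2 mxT_exp vec2Z mulr0 mulr1 exprS intrM rmorph_sign -pmulrn.
by rewrite -signr_odd; congr vec2; case: (odd n); case: (e) => /=; ring.
Qed.

(** The same cancellation with last letter i makes the image vertical, and the additional R turns it
    horizontal. *)
Lemma cf_g_inter a n i : exists e : bool,
  (mxR *m cf_g (rcons [seq a k | k <- iota 1 n] i))
    *m vec2 (inum a n i)%:R (iden a n i)%:R = (-1) ^+ e *: vec2 1 0 :> 'cV[R]_2.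
Proof.
have [e [h0 h1]] := cf_g_conv a n; exists (~~ e).
rewrite cf_g_rcons size_map size_iota -!mulmxA.
have -> : vec2 (inum a n i)%:R (iden a n i)%:R
    = i%:R *: vec2 (cnum a n.+1)%:R (cden a n.+1)%:R
      + vec2 (cnum a n)%:R (cden a n)%:R :> 'cV[R]_2.
  by apply: col2P; rewrite !mxE -natrM -natrD addnC.
rewrite mulmxDr -scalemxAr h1 h0.
have -> : i%:R *: (((-1) ^+ n * (-1) ^+ e) *: vec2 0 1)
    + (-1) ^+ e *: vec2 1 0
  = vec2 ((-1) ^+ e) (i%:R * (-1) ^+ n * (-1) ^+ e) :> 'cV[R]_2.
  by apply: col2P; rewrite !mxE /=; ring.
rewrite mulmxR_vec2 mxT_exp mulmxR_vec2 vec2Z mulr0 mulr1.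
rewrite intrM rmorph_sign -pmulrn -[(-1) ^+ n]signr_odd.
by congr vec2; case: (odd n); case: (e) => /=; ring.
Qed.

Lemma mult_infty_inter (O : origami) a n i :
  mult_infty (gl_act (mxR *m cf_g (rcons [seq a k | k <- iota 1 n] i))
                     (surf R O))
  = mult_dir (inum a n i) (iden a n i) (surf R O).
Proof.
have [e eE] := cf_g_inter a n i.
apply: (@mult_infty_act _ _ _ (inum a n i) (iden a n i) e); last exact: eE.
  by rewrite coprimezE coprime_inter.
by rewrite unitmx_mul mxR_unit cf_g_unit.
Qed.

End Matrices.

(** * Systole along the geodesic *)

Section Systole.
Variable R : realType.
Implicit Types (w : 'cV[R]_2) (O : origami).

Lemma det_mx2 (a b c d : R) : \det (mx2 a b c d) = a * d - b * c.
Proof.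
rewrite (expand_det_row _ 0) !big_ord_recl big_ord0 /cofactor !det_mx11 !mxE /=.
by rewrite !expr0 !expr1 /=; ring.
Qed.

Lemma norm2_ge0 w : 0 <= norm2 w. Proof. exact: sqrtr_ge0. Qed.

Lemma norm2_sqr w : norm2 w ^+ 2 = w 0 0 ^+ 2 + w 1 0 ^+ 2.
Proof. by rewrite sqr_sqrtr// addr_ge0 ?sqr_ge0. Qed.

Lemma norm2_eq0 w : norm2 w = 0 -> w = 0.
Proof.
move=> w0; have /esym/eqP := norm2_sqr w; rewrite w0 expr0n /=.
rewrite paddr_eq0 ?sqr_ge0// !sqrf_eq0 => /andP[/eqP e0 /eqP e1].
by apply: col2P; rewrite mxE.
Qed.

Lemma entry_le_norm2 w (i : 'I_2) : `|w i 0| <= norm2 w.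
Proof.
rewrite -sqrtr_sqr ler_wsqrtr//.
have [->|->] : i = 0 \/ i = 1.
- by case: i => [[|[|//]] ?]; [left|right]; exact/val_inj.
- by rewrite lerDl sqr_ge0.
- by rewrite lerDr sqr_ge0.
Qed.

(** With C the sum of the absolute values of the entries of the inverse; only finitely many integer
    vectors then have a bounded image. *)
Lemma norm2_mulmx_ge (F : 'M[R]_2) : F \in unitmx ->
  exists2 C, 0 <= C & forall w i, `|w i 0| <= C * norm2 (F *m w).
Proof.
move=> uF; exists (\sum_(i < 2) \sum_(j < 2) `|invmx F i j|).
  by apply: sumr_ge0 => i _; apply: sumr_ge0.
move=> w i; rewrite -{1}(mulKmx uF w) mxE.
apply: le_trans (ler_norm_sum _ _ _) _.
rewrite [X in _ <= X * _](bigD1 i)//= mulrDl ler_wpDr//.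
  apply: mulr_ge0 (norm2_ge0 _); apply: sumr_ge0 => k _.
  by apply: sumr_ge0.
rewrite mulr_suml; apply: ler_sum => j _.
by rewrite normrM ler_wpM2l// entry_le_norm2.
Qed.

(* [Sys] is a genuine minimum because the periods of an origami are discrete. *)
Lemma Sys_le O (F : 'M[R]_2) w : F \in unitmx -> Hol (surf R O) w ->
  0 < Sys (TSurface O F) <= norm2 (F *m w).
Proof.
move=> uF hw; have [C C0 hC] := norm2_mulmx_ge uF.
(* Periods whose image is no longer than that of w have integer coordinates in [-B, B]; they are
   encoded by ordinals shifted by B. *)
pose B := Num.Def.truncn (C * norm2 (F *m w)).
have BP : C * norm2 (F *m w) < B.+1%:R by apply: Num.Theory.truncnS_gt.
have HolF v : Hol (TSurface O F) v <-> Hol (surf R O) (invmx F *m v).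
  rewrite -(Hol_frame O 1%:M _ uF) mulKVmx// mulmx1.
  by [].
pose T : finType := ('I_(B.*2.+1) * 'I_(B.*2.+1))%type.
pose vec (u : T) : 'cV[R]_2 :=
  vec2 (u.1%:Z - B%:Z)%:~R (u.2%:Z - B%:Z)%:~R.
have vecP v : Hol (surf R O) v -> norm2 (F *m v) <= norm2 (F *m w) ->
    exists u, v = vec u.
  move=> hv vw; have [p [q vE]] := Z2P (Hol_Z2 hv).
  have bnd (z : int) i : v i 0 = z%:~R -> (`|z| <= B)%N.
    move=> viE; rewrite -ltnS -(ltr_nat R).
    apply: le_lt_trans BP; rewrite (_ : `|z|%:R = `|v i 0|).
      by apply: le_trans (hC v i) _; rewrite ler_wpM2l.
    by rewrite viE -intr_norm -abszE.
  have pB : (`|p| <= B)%N by apply: (bnd p 0); rewrite vE vec2_0.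
  have qB : (`|q| <= B)%N by apply: (bnd q 1); rewrite vE vec2_1.
  have ord_ (z : int) : (`|z| <= B)%N -> (`|(z + B%:Z)%R| < B.*2.+1)%N by clear; lia.
  exists (Ordinal (ord_ _ pB), Ordinal (ord_ _ qB)); rewrite vE /vec /=.
  by congr vec2; congr (_%:~R); lia.
pose P (u : T) := `[< Hol (surf R O) (vec u) >].
have [u0 wE] := vecP w hw (lexx _).
have Pu0 : P u0 by apply/asboolP; rewrite -wE.
case: (arg_minP (fun u => norm2 (F *m vec u)) Pu0) => m /asboolP hm m_min.
have minP v : Hol (surf R O) v -> norm2 (F *m vec m) <= norm2 (F *m v).
  move=> hv; have [le_vw|lt_wv] := leP (norm2 (F *m v)) (norm2 (F *m w)).
    have [u uE] := vecP v hv le_vw.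
    by rewrite uE; apply: m_min; apply/asboolP; rewrite -uE.
  by apply: le_trans (ltW lt_wv); rewrite wE; exact: m_min.
rewrite /Sys /minimum.
have [|[v hv vE] lb_v] := @xgetPex _ 0 ((@norm2 R @` Hol (TSurface O F))
    `&` lbound (@norm2 R @` Hol (TSurface O F))).
  exists (norm2 (F *m vec m)); split.
    by exists (F *m vec m) => //; apply/HolF; rewrite mulKmx.
  move=> _ [v /HolF hv <-]; rewrite -[v](mulKVmx uF); exact: minP.
apply/andP; split.
  rewrite -vE lt_neqAle norm2_ge0 andbT eq_sym.
  by have [v0 _] := hv; apply: contra_neq v0; exact: norm2_eq0.
by apply: lb_v; exists (F *m w) => //; apply/HolF; rewrite mulKmx.
Qed.

Lemma SysP (S : tsurface R) : Sys S = 0 \/ exists2 w, Hol S w & Sys S = norm2 w.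
Proof.
rewrite /Sys /minimum; case: xgetP => [_ -> [[w hw <-] _]|_]; last by left.
by right; exists w.
Qed.

End Systole.

(** * The Lagrange constant in terms of |y| |x - alpha y| *)

Section Lagrange.

(** The equality case of AM-GM: both squares are |x| |y|. *)
Lemma balanced_sqr (F : realFieldType) (r x y : F) : 0 < r ->
  r ^+ 2 * `|x| = `|y| ->
  (r * x) ^+ 2 + (r^-1 * y) ^+ 2 = 2 * (`|x| * `|y|).
Proof.
move=> r0 xy; rewrite !exprMn -(real_normK (num_real x)).
rewrite -(real_normK (num_real y)) -xy.
by field; rewrite gt_eqF.
Qed.

Variables (R : realType) (O : origami) (alpha : R).
Hypothesis O_gt0 : (0 < #|sq O|)%N.

Let N : R := #|sq O|%:R.
Let c : R := cos (atan alpha).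
Definition slope_surf (t : R) : tsurface R :=
  gl_act (mx_gt t) (normalize (gl_act (mx_rot (atan alpha)) (surf R O))).

Let N_gt0 : 0 < N. Proof. by rewrite ltr0n. Qed.

Let c_gt0 : 0 < c.
Proof. by rewrite /c cos_atan invr_gt0 sqrtr_gt0 ltr_pwDl ?sqr_ge0. Qed.

Let sinE : sin (atan alpha) = alpha * c.
Proof. by rewrite -{2}(atanK alpha) /tan mulfVK ?gt_eqF. Qed.

Let c_sqr : c ^+ 2 * (1 + alpha ^+ 2) = 1.
Proof. by rewrite -[RHS](cos2Dsin2 (atan alpha)) sinE /c; ring. Qed.

(** The coordinates after the rotation by arctan alpha, of cosine c: the line x = alpha y becomes
    vertical. *)
Definition re_part (x y : R) := c * (x - alpha * y).
Definition im_part (x y : R) := c * (alpha * x + y).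

Lemma slope_frame_vec2 t x y : frame (slope_surf t) *m vec2 x y =
  (Num.sqrt N)^-1 *: vec2 (expR t * re_part x y) (expR (- t) * im_part x y).
Proof.
rewrite /slope_surf /= /normalize /area /= !mulmx1.
have -> : \det (mx_rot (atan alpha)) = 1 :> R.
  by rewrite det_mx2 -[RHS](cos2Dsin2 (atan alpha)); ring.
rewrite normr1 mulr1 -/N -scalemxAr -scalemxAl -mulmxA mul_mx2_vec2 mul_mx2_vec2.
by rewrite sinE /re_part /im_part /c; congr (_ *: vec2 _ _); ring.
Qed.

Lemma slope_frame_unit t : frame (slope_surf t) \in unitmx.
Proof.
rewrite /slope_surf /= /normalize /area /= !mulmx1.
have rot1 : \det (mx_rot (atan alpha)) = 1 :> R.
  by rewrite det_mx2 -[RHS](cos2Dsin2 (atan alpha)); ring.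
rewrite rot1 normr1 mulr1 -scalemxAr unitmxZ; last first.
  by rewrite unitfE invr_eq0 gt_eqF// sqrtr_gt0.
rewrite unitmx_mul !unitmxE rot1 unitr1 andbT det_mx2.
by rewrite mul0r subr0 -expRD subrr expR0 unitr1.
Qed.

Lemma slope_norm2 t x y : norm2 (frame (slope_surf t) *m vec2 x y) ^+ 2
  = N^-1 * ((expR t * re_part x y) ^+ 2 + (expR (- t) * im_part x y) ^+ 2).
Proof.
rewrite slope_frame_vec2 norm2_sqr vec2Z vec2_0 vec2_1 !(exprMn _ (Num.sqrt N)^-1).
by rewrite -mulrDr exprVn sqr_sqrtr// ltW.
Qed.

(** Since c^2 (1 + alpha^2) = 1, the product is y (x - alpha y) up to an error of second order in x
    - alpha y. *)
Lemma re_im_part x y : re_part x y * im_part x y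
  = (x - alpha * y) * (y + c ^+ 2 * alpha * (x - alpha * y)).
Proof.
rewrite -[y in _ * (y + _)]mul1r -c_sqr /re_part /im_part; ring.
Qed.

Let csqr_itv : 0 < c ^+ 2 <= 1.
Proof.
rewrite exprn_gt0//=; have := c_sqr; have := sqr_ge0 (c * alpha).
by rewrite exprMn; lra.
Qed.

Let im_err_le d : `|c ^+ 2 * alpha * d| <= `|alpha| * `|d|.
Proof.
rewrite -mulrA normrM ger0_norm ?sqr_ge0// normrM ler_piMl ?mulr_ge0//.
by case/andP: csqr_itv.
Qed.

(** By AM-GM a period near the line has squared norm at least 2/N times the product of its parts;
    the other periods are stretched enough once t is large. *)
Lemma Lag_slope_le (k eta : R) : 0 < k -> 0 < eta ->
  (forall x y, Hol (surf R O) (vec2 x y) -> `|x - alpha * y| < eta ->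
     1 <= k * (`|y| * `|x - alpha * y|)) ->
  (Lag_slope (surf R O) alpha <= (N * k)%:E)%E.
Proof.
move=> k0 eta0 H; apply/lee_addgt0Pr => e e0.
(* [kap] bounds the relative error of |y| |x - alpha y| with respect to the
   product of the two parts once |x - alpha y| < del. *)
pose kap := Num.min 2^-1 (e / (2 * (N * k))).
have Nk : 0 < N * k by rewrite mulr_gt0.
have kap0 : 0 < kap by rewrite lt_min invr_gt0 ltr0n/= divr_gt0// mulr_gt0.
have kap2 : kap <= 2^-1 by rewrite ge_min lexx.
have kapE : 2 * (N * k) * kap <= e.
  rewrite mulrC -ler_pdivlMr ?mulr_gt0// ge_min lexx orbT //.
pose del := Num.min eta (Num.min 1 (kap / (k * (`|alpha| + 1)))).
have ka0 : 0 < k * (`|alpha| + 1) by rewrite mulr_gt0// ltr_wpDl.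
have del0 : 0 < del by rewrite !lt_min eta0 ltr01/= divr_gt0.
have delE : del <= eta by rewrite ge_min lexx.
have del1 : del <= 1 by rewrite !ge_min lexx orbT.
have delk : del * (k * (`|alpha| + 1)) <= kap.
  by rewrite -ler_pdivlMr// !ge_min lexx !orbT.
(* For t > A one has e^t c del >= sqrt(2/k), which settles the periods at distance at least
   [del]. *)
pose A := Num.sqrt (2 / k) / (c * del).
have A0 : 0 <= A by rewrite divr_ge0 ?sqrtr_ge0 ?mulr_ge0 ?ltW.
rewrite /Lag_slope /Lag limf_esupE; apply: ge_ereal_inf.
exists (ereal_sup ((fun t : R => (2 / Sys (slope_surf t) ^+ 2)%:E)
                   @` [set t | A < t])).
  exists [set t | A < t] => //.
  by exists A; split; first exact: num_real.
apply: ge_ereal_sup => _ [t /= At <-]; rewrite -EFinD lee_fin.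
(* If [Sys] is 0, the quotient 2/0 is 0 and the bound is trivial. *)
have [->|[v hv ->]] := SysP (slope_surf t).
  by rewrite expr0n invr0 mulr0 addr_ge0// ltW.
have [w wE] : exists w, v = frame (slope_surf t) *m w.
  by exists (invmx (frame (slope_surf t)) *m v); rewrite mulKVmx// slope_frame_unit.
have hw : Hol (surf R O) w.
  apply/(Hol_frame O 1%:M w (slope_frame_unit t)).
  by rewrite mulmx1 -wE; exact: hv.
rewrite {}wE [w]vec2_eta slope_norm2 in hw *.
move: (w 0 0) (w 1 0) hw => x y hw.
rewrite invfM invrK mulrCA.
set Q := _ ^+ 2 + _ ^+ 2.
suff kQ : 2 <= k * (1 + 2 * kap) * Q.
  have Q0 : 0 < Q.
    rewrite -(pmulr_rgt0 _ (x := k * (1 + 2 * kap))).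
      exact: lt_le_trans kQ.
    by rewrite mulr_gt0// addr_gt0// mulr_gt0.
  apply: (@le_trans _ _ (N * (k * (1 + 2 * kap)))).
    by rewrite ler_pM2l// ler_pdivrMr.
  by have := kapE; lra.
have kk : k <= k * (1 + 2 * kap).
  by have := mulr_gt0 k0 kap0; lra.
have [ge_del|lt_del] := leP del `|x - alpha * y|.
  have tA : A <= expR t.
    by apply: le_trans (ltW At) _; apply: le_trans (expR_ge1Dx t); rewrite lerDr.
  have : 2 / k <= (expR t * re_part x y) ^+ 2.
    rewrite -(sqr_sqrtr (_ : 0 <= 2 / k)); last by rewrite divr_ge0 ?ltW.
    rewrite -[leRHS]real_normK ?num_real// lerXn2r ?nnegrE ?sqrtr_ge0//.
    rewrite normrM ger0_norm ?expR_ge0// /re_part normrM (ger0_norm (ltW c_gt0)).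
    apply: (@le_trans _ _ (A * (c * del))).
      by rewrite mulfVK// mulf_neq0 ?gt_eqF.
    by apply: ler_pM => //; [exact: ltW (mulr_gt0 c_gt0 del0)|rewrite ler_pM2l].
  rewrite ler_pdivrMr// mulrC => h.
  apply: (le_trans h); apply: ler_pM; [exact: ltW|exact: sqr_ge0|exact: kk|].
  by rewrite /Q lerDl sqr_ge0.
have h1 := H x y hw (lt_le_trans lt_del delE).
have Q2 : 2 * (`|re_part x y * im_part x y|) <= Q.
  have -> : re_part x y * im_part x y
      = (expR t * re_part x y) * (expR (- t) * im_part x y).
    by rewrite [RHS]mulrACA -expRD subrr expR0 mul1r.
  rewrite /Q; move: (expR t * _) (expR (- t) * _) => f g.
  rewrite -[f ^+ 2]real_normK ?num_real// -[g ^+ 2]real_normK ?num_real// normrM.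
  by have := sqr_ge0 (`|f| - `|g|); lra.
set d := x - alpha * y in h1 lt_del *.
have d0 : 0 < `|d|.
  rewrite normr_gt0; apply: contraTneq h1 => ->.
  by rewrite normr0 !mulr0 -ltNge.
(* The hypothesis 1 <= k |y| |d| turns the error |alpha| |d| into at most kap |y|. *)
have prod : `|y| * `|d| * (1 - kap) <= `|re_part x y * im_part x y|.
  rewrite re_im_part -/d normrM (mulrC `|y|) -[leLHS]mulrA ler_wpM2l//.
  apply: le_trans (lerB_normD _ _); rewrite mulrBr mulr1 lerD2l lerN2.
  apply: le_trans (im_err_le d) _.
  have a0 := normr_ge0 alpha; have y0 := normr_ge0 y.
  apply: (@le_trans _ _ (`|alpha| * (`|d| * (k * (`|y| * `|d|))))).
    by rewrite ler_wpM2l// ler_peMr.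
  have dk : `|d| * (k * (`|alpha| + 1)) <= kap.
    by apply: le_trans delk; rewrite ler_wpM2r ?ltW.
  have d1 : `|d| <= 1 by exact: le_trans (ltW lt_del) del1.
  apply: (@le_trans _ _ (`|y| * (`|d| * (k * (`|alpha| + 1))))); last first.
    by rewrite ler_wpM2l.
  have -> : `|alpha| * (`|d| * (k * (`|y| * `|d|)))
     = `|y| * (`|d| * (k * (`|alpha| * `|d|))) by ring.
  by rewrite !ler_wpM2l //; nra.
set z := `|y| * `|d| in h1 prod *.
set z' := `|_ * _| in prod Q2.
have h2 : 1 <= (1 - kap) * (1 + 2 * kap) by nra.
apply: (@le_trans _ _ (k * (1 + 2 * kap) * (2 * z'))); last first.
  by rewrite ler_wpM2l// mulr_ge0 ?ltW// addr_gt0// mulr_gt0.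
apply: (@le_trans _ _ (k * (1 + 2 * kap) * (2 * (z * (1 - kap))))); last first.
  rewrite ler_wpM2l ?ler_wpM2l// mulr_ge0 ?addr_ge0 ?mulr_ge0 ?ltW//.
have -> : k * (1 + 2 * kap) * (2 * (z * (1 - kap)))
   = 2 * (k * z) * ((1 - kap) * (1 + 2 * kap)) by ring.
nra.
Qed.

(** When the coordinates of a period are equal in size, its squared norm is 2/N times the product of
    its parts, which bounds the squared systole. This time is late for a long period close to the
    line. *)
Lemma Lag_slope_ge (k : R) : 0 <= k ->
  (forall m : nat, exists x y, [/\ Hol (surf R O) (vec2 x y),
     m%:R <= `|y|, 0 < `|x - alpha * y| <= 1 &
     k * (`|y| * `|x - alpha * y|) <= 1]) ->
  ((N * k)%:E <= Lag_slope (surf R O) alpha)%E.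
Proof.
move=> k0 H; rewrite /Lag_slope /Lag limf_esupE; apply: le_ereal_inf_tmp.
move=> _ [V [T [_ TV]] <-]; apply/lee_addgt0Pr => e e0.
have Nk : 0 <= N * k by rewrite mulr_ge0// ltW.
(* The first term makes the replacement of |y| by |y| + |alpha| cost less than e; the others make
   the balancing time exceed T. *)
pose B := (`|alpha| + 1) * (N * k + 1) / e + `|alpha| + 1 + expR (2 * T) / c.
have [x [y [hw yB /andP[d0 d1] kyd]]] := H (Num.Def.truncn B).+1.
have {}yB : B <= `|y|.
  by apply: le_trans yB; apply: ltW; exact: Num.Theory.truncnS_gt.
set d := x - alpha * y in d0 d1 kyd.
have a0 := normr_ge0 alpha.
have B1 : 0 <= (`|alpha| + 1) * (N * k + 1) / e.
  by rewrite divr_ge0 ?mulr_ge0 ?addr_ge0// ltW.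
have B2 : 0 <= expR (2 * T) / c by rewrite divr_ge0 ?expR_ge0// ltW.
have y0 : 0 < `|y| by apply: lt_le_trans yB; rewrite /B; lra.
have yE : (`|alpha| + 1) * (N * k + 1) <= e * `|y|.
  by rewrite mulrC -ler_pdivrMl// mulrC; apply: le_trans yB; rewrite /B; lra.
have X0 : 0 < `|re_part x y| by rewrite /re_part normrM mulr_gt0// gtr0_norm.
have c1 : c <= 1.
  by have /andP[_] := csqr_itv; rewrite expr_le1// ltW.
have X1 : `|re_part x y| <= 1.
  by rewrite /re_part normrM gtr0_norm// mulr_ile1// ltW.
have aE : `|c ^+ 2 * alpha * d| <= `|alpha|.
  by apply: le_trans (im_err_le d) _; rewrite ler_piMr.
have prod_le : `|re_part x y| * `|im_part x y| <= `|d| * (`|y| + `|alpha|).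
  rewrite -normrM re_im_part -/d normrM ler_wpM2l//.
  by apply: le_trans (ler_normD _ _) _; rewrite lerD2l.
have Y_ge : expR (2 * T) < `|im_part x y|.
  have -> : im_part x y = c^-1 * (y + c ^+ 2 * alpha * d).
    rewrite -[y in _ * (y + _)]mul1r -c_sqr /im_part /d.
    by field; rewrite gt_eqF.
  rewrite normrM gtr0_norm ?invr_gt0// [ltRHS]mulrC ltr_pdivlMr//.
  apply: lt_le_trans (lerB_normD _ _).
  have : expR (2 * T) * c <= expR (2 * T) / c.
    by rewrite ler_wpM2l ?expR_ge0// (le_trans c1)// invf_ge1.
  by move: yB; rewrite /B; lra.
have Y0 : 0 < `|im_part x y| by apply: le_lt_trans Y_ge; exact: expR_ge0.
(* The time at which the two coordinates of the period are equal. *)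
pose t := ln (`|im_part x y| / `|re_part x y|) / 2.
have e2t : expR (2 * t) = `|im_part x y| / `|re_part x y|.
  by rewrite mulrC mulfVK// lnK// posrE divr_gt0.
have Tt : T < t.
  rewrite -(ltr_pM2l (_ : 0 < 2 :> R))// -ltr_expR e2t.
  by apply: lt_le_trans Y_ge _; rewrite ler_peMr ?(ltW Y0)// invf_ge1.
have Vt := TV t Tt.
apply: (@le_trans _ _ ((2 / Sys (slope_surf t) ^+ 2)%:E + e%:E)); last first.
  by rewrite leeD2r//; apply: ereal_sup_ubound; exists t.
rewrite -EFinD lee_fin.
have /andP[S0 SE] : 0 < Sys (slope_surf t)
    <= norm2 (frame (slope_surf t) *m vec2 x y).
  exact: (Sys_le (slope_frame_unit t) hw).
have S2 : Sys (slope_surf t) ^+ 2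
    <= N^-1 * (2 * (`|re_part x y| * `|im_part x y|)).
  apply: (@le_trans _ _ (norm2 (frame (slope_surf t) *m vec2 x y) ^+ 2)).
    by rewrite lerXn2r ?nnegrE ?norm2_ge0 ?(ltW S0).
  rewrite slope_norm2 ler_wpM2l ?invr_ge0 ?(ltW N_gt0)//.
  have E0 := expR_gt0 t; have EY : expR t ^+ 2 * `|re_part x y| = `|im_part x y|.
    by rewrite -expRM_natl e2t mulfVK ?gt_eqF.
  by rewrite expRN balanced_sqr.
set XY := `|_| * _ in S2 prod_le.
have XY0 : 0 < XY by rewrite mulr_gt0.
rewrite -lerBlDr ler_pdivlMr ?exprn_gt0//.
have [le0|gt0] := leP (N * k - e) 0.
  by apply: le_trans (_ : 0 <= _) => //; rewrite mulr_le0_ge0 ?sqr_ge0.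
apply: (@le_trans _ _ ((N * k - e) * (N^-1 * (2 * XY)))).
  by rewrite ler_wpM2l// ltW.
have -> : (N * k - e) * (N^-1 * (2 * XY)) = 2 * ((N * k - e) * XY / N) by ring.
rewrite ler_piMr// ler_pdivrMr// mul1r.
apply: (@le_trans _ _ ((N * k - e) * (`|d| * (`|y| + `|alpha|)))).
  by rewrite ler_wpM2l// ltW.
have h1 : N * (k * (`|y| * `|d|)) <= N by rewrite ler_piMr// ltW.
have h2 : `|d| * ((`|alpha| + 1) * (N * k + 1)) <= `|d| * (e * `|y|).
  by rewrite ler_wpM2l.
have da := mulr_ge0 (ltW d0) a0; have dN := mulr_ge0 (ltW d0) Nk.
have := mulr_ge0 (ltW e0) da; lra.
Qed.

End Lagrange.

(** * Approximations of the slope *)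

Section LimsupBounds.
Variable R : realType.

Lemma bigmax_nat_gt (k : R) m (F : nat -> R) : 0 <= k ->
  k < \big[Num.max/0]_(1 <= i < m.+1) F i ->
  exists2 i, (0 < i <= m)%N & k < F i.
Proof.
move=> k0; apply: contraPP => noi; apply/negP; rewrite -leNgt big_nat_cond.
apply: bigmax_le => // i /andP[im _]; rewrite leNgt; apply/negP => kF.
by apply: noi; exists i.
Qed.

Lemma bigmax_nat_ge m (F : nat -> R) i : (0 < i <= m)%N ->
  F i <= \big[Num.max/0]_(1 <= j < m.+1) F j.
Proof.
by move=> im; apply: le_bigmax_seq => //; rewrite mem_index_iota.
Qed.

Lemma limn_esup_gt (u : nat -> \bar R) (l : \bar R) n0 : (l < limn_esup u)%E ->
  exists2 n, (n0 <= n)%N & (l < u n)%E.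
Proof.
move=> lu; have : (l < ereal_sup (u @` [set n | (n0 <= n)%N]))%E.
  apply: lt_le_trans lu _; rewrite /limn_esup limf_esupE; apply: ge_ereal_inf.
  by exists (ereal_sup (u @` [set n | (n0 <= n)%N])) => //;
    exists [set n | (n0 <= n)%N] => //; exists n0.
by move=> /ereal_sup_gt[_ [n n0n <-] lun]; exists n.
Qed.

Lemma limn_esup_lt (u : nat -> \bar R) (l : \bar R) : (limn_esup u < l)%E ->
  exists n0, forall n, (n0 <= n)%N -> (u n <= l)%E.
Proof.
rewrite /limn_esup limf_esupE => /ereal_inf_lt[_ [V [n0 _ n0V] <-] /ltW supV].
exists n0 => n n0n; apply: le_trans supV.
by apply: ereal_sup_ubound; exists n => //; exact: n0V.
Qed.

(** Reduces a lower bound by a possibly infinite upper limit to finite k below it. *)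
Lemma ereal_gt_density (N : R) (x l : \bar R) : 0 < N -> (0 <= l)%E ->
  (forall k, 0 <= k -> (k%:E < l)%E -> ((N * k)%:E <= x)%E) ->
  (0 <= x)%E -> (N%:E * l <= x)%E.
Proof.
move=> N0 + H; case: x H => [x||]//=; rewrite ?leey// lee_fin => H + x0.
case: l H => [l||]// H; rewrite ?lee_fin => l0; last first.
  have k0 : 0 <= x / N + 1 by rewrite addr_ge0 ?divr_ge0 ?(ltW N0).
  have {H l0} := H _ k0 (ltry _).
  by rewrite lee_fin mulrDr mulr1 mulrC divfK ?gt_eqF// => h; exfalso; lra.
rewrite leNgt; apply/negP => xl.
have xl' : x / N < l by rewrite ltr_pdivrMr// mulrC.
have k0 : 0 <= (x / N + l) / 2.
  by rewrite divr_ge0 ?addr_ge0 ?divr_ge0 ?(ltW N0).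
have := H _ k0; rewrite lte_fin lee_fin midf_lt// => /(_ isT).
rewrite leNgt => /negP; apply.
by rewrite mulrC -ltr_pdivrMr// midf_lt.
Qed.

End LimsupBounds.

(** * Periods close to the line of slope alpha *)

Section Approximation.
Variables (R : realType) (a : nat -> nat) (alpha : R).
Hypothesis a_gt0 : forall n, (0 < n)%N -> (0 < a n)%N.
Hypothesis alpha_cf : alpha = cf_inf (fun k => a k.+1).
Hypothesis alpha_lt1 : alpha < 1.

Let err1 : err a alpha 1 = alpha.
Proof. by rewrite /err expr1 /cnum /cden /=; ring. Qed.

Let alpha_gt0 : 0 < alpha. Proof. by rewrite -err1 err_gt0. Qed.

Lemma err_dist n i :
  `|(inum a n i)%:R - alpha * (iden a n i)%:R| = `|ierr a alpha n i|.
Proof. by rewrite ierrE normrM normr_sign mul1r mulrC. Qed.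

Lemma conv_dist n : `|(cnum a n)%:R - alpha * (cden a n)%:R| = err a alpha n.
Proof. by rewrite -inum0 -iden0 err_dist ierr0 gtr0_norm// err_gt0. Qed.

(** By [err_den] the error is at most 1/q_(n+2). This keeps bounded multiples of late convergents
    within distance 1 of the line. *)
Lemma err_small n : err a alpha n.+1 * n%:R <= 1.
Proof.
have e0 := err_gt0 a_gt0 alpha_cf.
apply: (@le_trans _ _ (err a alpha n.+1 * (cden a n.+2)%:R)).
  rewrite ler_pM2l// ler_nat -iden_last; apply: leq_iden => //; exact: a_gt0.
rewrite -[leRHS](err_den a alpha n.+1) [leLHS]mulrC lerDl mulr_ge0 ?ler0n//; exact: ltW.
Qed.

(** For denominators p, q and errors x, y of the two neighbours, q x - p y = 1, so the product is
    s^2 p x + r^2 q y + s r (1 + 2 p y). *)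
Lemma cone_product n i (s r : R) : 1 <= s -> 1 <= r -> (i < a n.+1)%N ->
  (iden a n i)%:R * ierr a alpha n i + (iden a n i.+1)%:R * ierr a alpha n i.+1
    + 1
  <= (s * (iden a n i)%:R + r * (iden a n i.+1)%:R)
     * (s * ierr a alpha n i + r * ierr a alpha n i.+1).
Proof.
move=> s1 r1 ia; have e1 := ierr_gt0 a_gt0 alpha_cf (ltnW ia).
have e2 := ierr_gt0 a_gt0 alpha_cf ia.
have := ierr_iden a alpha n i.
have q' : (iden a n i.+1)%:R = (iden a n i)%:R + (cden a n.+1)%:R :> R.
  by rewrite -natrD; congr (_%:R); rewrite /iden mulSn; lia.
have e' : ierr a alpha n i.+1 = ierr a alpha n i - err a alpha n.+1.
  by rewrite /ierr -natr1; ring.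
have q0 := ler0n R (iden a n i); have q1 := ler0n R (iden a n i.+1).
move: e1 e2 q' e' q0 q1.
move: (ierr a alpha n i) (ierr a alpha n i.+1) (iden a n i)%:R (iden a n i.+1)%:R.
move: (err a alpha n.+1) (cden a n.+1)%:R => f g x y p q.
move=> x0 y0 qE yE p0 q0 det.
have {}det : q * x - p * y = 1 by rewrite qE yE -det; ring.
have sr : 1 <= s * r by nra.
have px := mulr_ge0 p0 (ltW x0); have qy := mulr_ge0 q0 (ltW y0).
have py := mulr_ge0 p0 (ltW y0).
have -> : (s * p + r * q) * (s * x + r * y)
  = s ^+ 2 * (p * x) + r ^+ 2 * (q * y) + s * r * (1 + 2 * (p * y)).
  by rewrite -[X in s * r * (X + _)]det; ring.
have s2 : 1 <= s ^+ 2 by rewrite exprn_ege1.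
have r2 : 1 <= r ^+ 2 by rewrite exprn_ege1.
have h1 : p * x <= s ^+ 2 * (p * x) by rewrite ler_peMl.
have h2 : q * y <= r ^+ 2 * (q * y) by rewrite ler_peMl.
have h3 : 1 <= s * r * (1 + 2 * (p * y)).
  by rewrite -[leLHS]mulr1; apply: ler_pM => //; lra.
lra.
Qed.

(* A vector close to the line of slope alpha is a multiple of a late
   intermediate convergent or lies in a late cone between two of them. *)
Lemma Hol_approx_bound (O : origami) (k : R) n0 : 0 < k ->
  (forall n i (e : int), (n0 <= n)%N -> (0 < i <= a n.+1)%N ->
    Hol (surf R O) (e%:~R *: vec2 (inum a n i)%:R (iden a n i)%:R) ->
    1 <= k * (e%:~R ^+ 2 * ((iden a n i)%:R * ierr a alpha n i))) ->
  (forall n i, (n0.+2 <= n)%N -> (i < a n.+1)%N ->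
    1 <= k * ((iden a n i)%:R * ierr a alpha n i
              + (iden a n i.+1)%:R * ierr a alpha n i.+1 + 1)) ->
  exists2 eta, 0 < eta & forall x y, Hol (surf R O) (vec2 x y) ->
    `|x - alpha * y| < eta -> 1 <= k * (`|y| * `|x - alpha * y|).
Proof.
move=> k0 Hinter Hcone.
have e_gt0 := err_gt0 a_gt0 alpha_cf.
have ie_gt0 n i : (i <= a n.+1)%N -> 0 < ierr a alpha n i.
  exact: ierr_gt0.
(* An intermediate error of index n is at least err_(n+2), so this threshold forces n > n0 + 2; the
   margin 2 allows a convergent to be read as the last intermediate one two indices earlier. *)
exists (err a alpha n0.+4) => // x y hxy.
have [X [Y]] := Z2P (Hol_Z2 hxy); move=> /vec2_inj[xE yE].
have [v0 _] := hxy.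
have XY0 : (X != 0) || (Y != 0).
  apply: contraNT v0; rewrite negb_or !negbK => /andP[/eqP X0 /eqP Y0].
  by rewrite xE yE X0 Y0 vec2_00.
rewrite {}xE {}yE in hxy *.
have [e [p [q [pq q0 e0 XE YE]]]] : exists e p q : int,
    [/\ coprimez p q, 0 <= q, e != 0, X = e * p & Y = e * q].
  have g0 : gcdz X Y != 0 by rewrite gcdz_eq0 negb_and.
  have [p pE] := dvdzP (dvdz_gcdl X Y); have [q qE] := dvdzP (dvdz_gcdr X Y).
  have pq : coprimez p q.
    have : gcdz X Y = gcdz p q * `|gcdz X Y|%N by rewrite mulz_gcdl -pE -qE.
    by rewrite gez0_abs// -[LHS]mul1r => /(mulIf g0)/esym/eqP.
  have [q0|q0] := leP 0 q.
    by exists (gcdz X Y), p, q; split; rewrite // mulrC.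
  exists (- gcdz X Y), (- p), (- q); split; rewrite ?mulrNN ?oppr_eq0 1?mulrC//.
    by rewrite coprimezE !abszN -coprimezE.
  by rewrite oppr_ge0 ltW.
have e1 : 1 <= `|e%:~R| :> R by rewrite -intr_norm ler1z -gtz0_ge1 normr_gt0.
have dE : X%:~R - alpha * Y%:~R = e%:~R * (p%:~R - alpha * q%:~R).
  by rewrite XE YE !intrM; ring.
rewrite dE normrM => hd.
have {}hd : `|p%:~R - alpha * q%:~R| < err a alpha n0.+4.
  by apply: le_lt_trans hd; rewrite ler_peMl.
(* A distance below alpha excludes q = 0, where it is 1, and p < 0, where it exceeds alpha. *)
have del_lt : `|p%:~R - alpha * q%:~R| < alpha.
  by apply: lt_le_trans hd _; rewrite -[leRHS]err1; exact: err_anti.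
have q1 : 1 <= q.
  rewrite -gtz0_ge1 lt_neqAle q0 andbT eq_sym; apply: contraTneq del_lt => qz.
  move: pq; rewrite qz coprimezE /coprime absz0 gcdn0 => /eqP p1.
  by rewrite mulr0 subr0 -intr_norm -abszE p1 -leNgt ltW.
have p0 : 0 <= p.
  rewrite -ltzD1; rewrite -(ltr_int R) intrD mulr1z.
  have : alpha <= alpha * q%:~R.
    by rewrite ler_peMr ?(ltW alpha_gt0)// ler1z.
  by move: del_lt; rewrite ltr_norml => /andP[]; lra.
case: p p0 XE pq hd dE del_lt => // p _ XE pq hd dE _.
case: q q0 q1 YE pq hd dE => // q _ q1 YE pq hd dE.
rewrite coprimezE /= in pq.
have hxy' : Hol (surf R O) (e%:~R *: vec2 p%:R q%:R).
  by move: hxy; rewrite XE YE !intrM -vec2Z.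
rewrite YE intrM normrM -!pmulrn (ger0_norm (ler0n R q)).
have -> : k * (`|e%:~R| * q%:R * (`|e%:~R| * `|p%:R - alpha * q%:R|))
  = k * (e%:~R ^+ 2 * (q%:R * `|p%:R - alpha * q%:R|)).
  by rewrite -[e%:~R ^+ 2](real_normK (num_real _)); ring.
rewrite -!pmulrn in hd.
have late m : err a alpha m < err a alpha n0.+4 -> (n0.+4 < m)%N.
  by move=> h; rewrite ltnNge; apply: contraTN h => /(err_anti a_gt0 alpha_cf);
    rewrite -leNgt.
have conv_case m : p = cnum a m -> q = cden a m -> (n0.+2 < m)%N ->
    1 <= k * (e%:~R ^+ 2 * (q%:R * `|p%:R - alpha * q%:R|)).
  move=> pE qE; case: m pE qE => [|[|m]]// pE qE mn0.
  have := Hinter m (a m.+1) e; rewrite inum_last iden_last -pE -qE => h.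
  have := conv_dist m.+2; rewrite -pE -qE ierr_last in h * => ->.
  by apply: h => //; [lia|rewrite a_gt0//=].
have [n [[pE qE]|[i ia [pE qE]]|[i [s [r [ia s0 r0 pE qE]]]]]] :=
  convergent_cone a_gt0 pq.
- apply: (conv_case n) => //.
  by rewrite pE qE conv_dist in hd; apply: ltn_trans (late _ hd).
- have nlate : (n0.+4 < n.+2)%N.
    apply: late; apply: le_lt_trans hd.
    rewrite pE qE err_dist gtr0_norm ?ie_gt0 1?ltnW//.
    by apply: ierr_ge => //; exact: ltnW.
  have [i0|i0] := posnP i.
    by apply: (conv_case n); rewrite ?pE ?qE ?i0 ?inum0 ?iden0.
  rewrite pE qE err_dist gtr0_norm ?ie_gt0 1?ltnW//.
  apply: Hinter; rewrite -?pE -?qE//; first by lia.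
  by rewrite i0 ltnW.
have dist : `|p%:R - alpha * q%:R|
    = s%:R * ierr a alpha n i + r%:R * ierr a alpha n i.+1.
  have -> : p%:R - alpha * q%:R
      = (-1) ^+ n * (s%:R * ierr a alpha n i + r%:R * ierr a alpha n i.+1).
    transitivity (((-1) ^+ n) ^+ 2 * (p%:R - alpha * q%:R)).
      by rewrite sqrr_sign mul1r.
    rewrite !ierrE pE qE; move: (inum a n i) (inum a n i.+1) (iden a n i).
    move: (iden a n i.+1) => J I' I J'; rewrite !natrD !natrM; ring.
  rewrite normrM normr_sign mul1r ger0_norm// addr_ge0// mulr_ge0// ltW//.
    by rewrite ie_gt0 1?ltnW.
  by rewrite ie_gt0.
have s1 : 1 <= s%:R :> R by rewrite ler1n.
have r1 : 1 <= r%:R :> R by rewrite ler1n.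
(* Since s >= 1, the distance is at least the error at i, hence at least err_(n+2). *)
have nlate : (n0.+4 < n.+2)%N.
  apply: late; apply: le_lt_trans hd; rewrite dist.
  apply: (@le_trans _ _ (ierr a alpha n i)).
    by apply: ierr_ge => //; exact: ltnW.
  have := ie_gt0 n i (ltnW ia); have := ie_gt0 n i.+1 ia; nra.
apply: le_trans (Hcone n i _ ia) _; first by lia.
rewrite ler_pM2l// dist qE natrD !natrM.
apply: le_trans (cone_product s1 r1 ia) _.
have x0 := ltW (ie_gt0 n i (ltnW ia)); have y0 := ltW (ie_gt0 n i.+1 ia).
apply: ler_peMl; first by rewrite mulr_ge0 ?addr_ge0 ?mulr_ge0.
by rewrite -[e%:~R ^+ 2](real_normK (num_real _)) exprn_ege1.
Qed.

End Approximation.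

(** * The formula *)

Section Formula.
Variables (R : realType) (O : origami) (a : nat -> nat) (alpha : R).
Hypothesis a_gt0 : forall n, (0 < n)%N -> (0 < a n)%N.
Hypothesis alpha_cf : alpha = cf_inf (fun k => a k.+1).
Hypothesis alpha_lt1 : alpha < 1.
Variable x0 : tile_pt R O.
Hypothesis x0_singular : singular x0.

Let N : R := #|sq O|%:R.
Let M := max_mult R O.
Let m n i := mult_dir (inum a n i) (iden a n i) (surf R O).

Let sq_gt0 : (0 < #|sq O|)%N.
Proof.
have [s _] := cone_order_gt0 (singular_cone x0_singular).
by apply/card_gt0P; exists s.
Qed.

Let m_gt0 n i : (0 < i)%N -> (0 < m n i)%N.
Proof.
move=> i0; apply: mult_dir_gt0 x0_singular;
  [exact: iden_gt0|exact: coprime_inter].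
Qed.

Let m_le n i : (0 < i)%N -> (m n i <= M)%N.
Proof.
move=> i0; apply: mult_dir_le_max x0_singular;
  [exact: iden_gt0|exact: coprime_inter].
Qed.

Let m_attained n i : (0 < i)%N -> exists k : int, [/\ k != 0, `|k|%N = m n i &
  Hol (surf R O) (k%:~R *: vec2 (inum a n i)%:R (iden a n i)%:R)].
Proof.
move=> i0.
have h := @mult_dir_attained R O (inum a n i) (iden a n i) x0.
exact: (h (iden_gt0 a_gt0 n i0) (coprime_inter a n i) x0_singular).
Qed.

Let M_gt0 : (0 < M)%N.
Proof. exact: leq_trans (m_gt0 0 (ltn0Sn 0)) (m_le 0 (ltn0Sn 0)). Qed.

(** The quantity q |q alpha - p|, by [cf_DE] the inverse of [cf_D a n.+1 i]. *)
Let qd n i := (iden a n i)%:R * ierr a alpha n i.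

Let qd_gt0 n i : (0 < i <= a n.+1)%N -> 0 < qd n i.
Proof.
by move=> /andP[i0 ia]; rewrite mulr_gt0 ?ltr0n ?iden_gt0 ?ierr_gt0.
Qed.

Let ratio_le mu n i : (0 < i <= a n.+1)%N ->
  (cf_D a n.+1 i / (m n i)%:R ^+ 2 <= mu) = (1 <= mu * ((m n i)%:R ^+ 2 * qd n i)).
Proof.
move=> ia; have q0 := qd_gt0 ia; case/andP: (ia) => i0 _.
have m0 : 0 < (m n i)%:R :> R by rewrite ltr0n m_gt0.
rewrite (cf_DE a_gt0 alpha_cf)// -/(qd n i) -invfM -[_^-1]mul1r ler_pdivrMr.
  by rewrite [qd n i * _]mulrC.
by rewrite mulr_gt0// exprn_gt0.
Qed.

Let ratio_lt mu n i : (0 < i <= a n.+1)%N ->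
  (mu < cf_D a n.+1 i / (m n i)%:R ^+ 2) = (mu * ((m n i)%:R ^+ 2 * qd n i) < 1).
Proof. by move=> ia; rewrite !ltNge ratio_le. Qed.

(** Multiplied by M^2 mu, the cone bound 1 + F(v) + F(w) with F >= 1/(M^2 mu) becomes at least M^2
    mu + 2, hence at least M^2 by the last hypothesis. *)
Lemma Lag_slope_upper (mu : R) n0 : 0 < mu ->
  (forall n i, (n0 <= n)%N -> (0 < i <= a n.+1)%N ->
     cf_D a n.+1 i / (m n i)%:R ^+ 2 <= mu) ->
  M%:R ^+ 2 <= M%:R ^+ 2 * mu + 2 ->
  (Lag_slope (surf R O) alpha <= (N * mu)%:E)%E.
Proof.
move=> mu0 H Mmu.
have M0 : 0 < M%:R ^+ 2 :> R by rewrite exprn_gt0// ltr0n.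
have Hinter n i : (n0 <= n)%N -> (0 < i <= a n.+1)%N ->
    1 <= mu * ((m n i)%:R ^+ 2 * qd n i).
  by move=> n0n ia; rewrite -ratio_le//; exact: H.
have Hside n i : (n0 <= n)%N -> (0 < i <= a n.+1)%N ->
    1 <= mu * (M%:R ^+ 2 * qd n i).
  move=> n0n ia; apply: le_trans (Hinter _ _ n0n ia) _.
  rewrite ler_pM2l// ler_pM2r ?qd_gt0//.
  by case/andP: (ia) => i0 _; rewrite lerXn2r ?nnegrE ?ler0n// ler_nat m_le.
have Hside0 n i : (n0.+2 <= n)%N -> (i <= a n.+1)%N ->
    1 <= mu * (M%:R ^+ 2 * qd n i).
  (* For i = 0 the vector is the convergent n, the last intermediate one of index n - 2. *)
  move=> n0n ia; have [i0|i0] := posnP i; last first.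
    by apply: Hside; rewrite ?i0//; lia.
  case: n n0n {ia} => [|[|n]]// n0n.
  have := Hside n (a n.+1); rewrite /qd i0 ierr0 iden0 ierr_last iden_last.
  by apply; [lia|rewrite a_gt0/=].
have [||eta eta0 Heta] :=
  @Hol_approx_bound R a alpha a_gt0 alpha_cf alpha_lt1 O mu n0 mu0.
- move=> n i e n0n ia he; apply: le_trans (Hinter _ _ n0n ia) _.
  rewrite ler_pM2l// ler_pM2r ?qd_gt0//.
  rewrite -[leRHS](real_normK (num_real _)) -intr_norm -abszE.
  rewrite lerXn2r ?nnegrE ?ler0n// ler_nat.
  apply: (@mult_dir_le R O (inum a n i) (iden a n i)) => //.
  by rewrite coprimezE coprime_inter.
- move=> n i n0n ia; have := Hside0 _ _ n0n (ltnW ia).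
  have := Hside0 _ _ n0n ia; rewrite -!/(qd _ _) => h1 h2.
  rewrite -(ler_pM2l M0) mulr1; apply: le_trans Mmu _; lra.
exact: Lag_slope_le eta0 Heta.
Qed.

Let u n := \big[Num.max/0]_(1 <= i < (a n).+1)
  (cf_D a n i / (mult_infty
     (gl_act (mxR *m cf_g (rcons [seq a k | k <- iota 1 n.-1] i))
             (surf R O)))%:R ^+ 2) : R.

Let uE n : u n.+1
  = \big[Num.max/0]_(1 <= i < (a n.+1).+1) (cf_D a n.+1 i / (m n i)%:R ^+ 2).
Proof. by apply: eq_bigr => i _; rewrite mult_infty_inter. Qed.

Let lambda := limn_esup (fun n => (u n)%:E).

Let lambda_ge0 : (0 <= lambda)%E.
Proof.
apply: limf_esup_ge0 => [|n]; first by case=> n _ /(_ n (leqnn n)).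
by rewrite lee_fin; exact: bigmax_ge_id.
Qed.

Let lambda_lt_ratio (mu : R) : (lambda < mu%:E)%E -> exists n0, forall n i,
  (n0 <= n)%N -> (0 < i <= a n.+1)%N -> cf_D a n.+1 i / (m n i)%:R ^+ 2 <= mu.
Proof.
move=> /limn_esup_lt[n0 hn0]; exists n0 => n i n0n ia.
apply: le_trans (_ : u n.+1 <= mu); last first.
  by rewrite -lee_fin; apply: hn0; exact: leqW.
rewrite uE.
exact: (bigmax_nat_ge (fun i => cf_D a n.+1 i / (m n i)%:R ^+ 2) ia).
Qed.

(** A late ratio above k is realized by a saddle connection of least multiplicity in the direction
    of that intermediate convergent. *)
Lemma Lag_slope_lower : (N%:E * lambda <= Lag_slope (surf R O) alpha)%E.
Proof.
have N0 : 0 < N by rewrite ltr0n.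
apply: ereal_gt_density => //; last first.
  apply: limf_esup_ge0 => [|t]; last by rewrite lee_fin divr_ge0 ?sqr_ge0.
  by move=> [T [_ /(_ (T + 1))]]; apply; rewrite ltrDl.
move=> k k0 kl; apply: Lag_slope_ge => // j.
(* Beyond j the period satisfies |y| >= j; beyond M its distance is at most M err_(n+1) <= n
   err_(n+1) <= 1. *)
have [[|[|n]] nj] := limn_esup_gt (j + M).+2 kl; rewrite ?lte_fin// uE.
move=> /(bigmax_nat_gt k0)[i ia]; rewrite ratio_lt// => klt.
case/andP: (ia) => i0 ia'.
have [e [e0 eM he]] := m_attained n.+1 i0.
have e_gt0 := ierr_gt0 a_gt0 alpha_cf ia'.
have eE : `|e%:~R| = (m n.+1 i)%:R :> R by rewrite -intr_norm -abszE eM.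
exists (e%:~R * (inum a n.+1 i)%:R), (e%:~R * (iden a n.+1 i)%:R).
rewrite -vec2Z mulrCA -mulrBr !normrM eE ger0_norm ?ler0n//.
rewrite err_dist gtr0_norm//.
have m1 : 1 <= (m n.+1 i)%:R :> R by rewrite ler1n m_gt0.
split => //.
- rewrite -natrM ler_nat.
  apply: leq_trans (leq_pmull _ (m_gt0 _ i0)).
  by apply: leq_trans (leq_iden a_gt0 n.+1 i0); lia.
- rewrite mulr_gt0 ?(lt_le_trans ltr01 m1)//=.
  apply: le_trans (err_small a_gt0 alpha_cf n); rewrite mulrC.
  apply: ler_pM; rewrite ?ler0n ?(ltW e_gt0)//.
    by rewrite /ierr gerBl mulr_ge0 ?ler0n// ltW// err_gt0.
  by rewrite ler_nat; have := m_le n.+1 i0; lia.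
- apply: le_trans (ltW klt); rewrite ler_wpM2l// /qd.
  by rewrite le_eqVlt; apply/orP; left; apply/eqP; ring.
Qed.

(* If lambda were too small for [Lag_slope_upper], then the convergents of
   alpha would be too bad approximations for L(T^2, alpha) > M^2 - 2. *)
Lemma lambda_large (mu : R) : 0 < mu -> (lambda < mu%:E)%E ->
  ((M%:R ^+ 2 - 2)%:E < Lag_slope (surf R torus) alpha)%E ->
  M%:R ^+ 2 <= M%:R ^+ 2 * mu + 2.
Proof.
move=> mu0 /lambda_lt_ratio[n0 H] L_large; rewrite leNgt; apply/negP => Mmu.
(* For M = 1 the negated claim would read mu + 2 < 1. *)
have M2 : (2 <= M)%N.
  case: M Mmu M_gt0 => [|[|//]]//; rewrite expr1n; lra.
have k1 : 1 <= M%:R ^+ 2 - 2 :> R.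
  have : 4 <= M%:R ^+ 2 :> R by rewrite -natrX ler_nat (@leq_exp2r 2 M 2).
  lra.
have k0 : 0 < M%:R ^+ 2 - 2 :> R by lra.
(* On the torus the constant M^2 - 2 > M^2 mu works: late intermediate convergents have F >= 1/(M^2
   mu), and in the cones F >= 1 suffices as M^2 - 2 >= 1. *)
have [||eta eta0 Heta] :=
  @Hol_approx_bound R a alpha a_gt0 alpha_cf alpha_lt1 torus _ n0 k0.
- move=> n i e n0n ia [e0 _]; rewrite -/(qd n i).
  have q0 := qd_gt0 ia.
  have := H n i n0n ia; rewrite ratio_le//; case/andP: (ia) => i0 _ h.
  apply: (le_trans h).
  apply: (@le_trans _ _ (mu * (M%:R ^+ 2 * qd n i))).
    rewrite ler_pM2l// ler_pM2r// lerXn2r ?nnegrE ?ler0n// ler_nat; exact: m_le.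
  have muM := mulr_ge0 (ltW mu0) (sqr_ge0 (M%:R : R)).
  rewrite mulrA; apply: ler_pM; [exact: muM|exact: ltW|lra|].
  rewrite ler_peMl ?(ltW q0)// -[leRHS](real_normK (num_real _)) exprn_ege1//.
  rewrite -intr_norm ler1z -gtz0_ge1 normr_gt0; apply: contraNneq e0 => ->.
  by rewrite scale0r.
- move=> n i n0n ia; apply: (le_trans k1); rewrite ler_peMr ?(ltW k0)// lerDr.
  have ie j : (j <= a n.+1)%N -> 0 <= (iden a n j)%:R * ierr a alpha n j.
    by move=> ja; rewrite mulr_ge0 ?ler0n// ltW// ierr_gt0.
  by rewrite addr_ge0 ?ie// ltnW.
have torus_gt0 : (0 < #|sq torus|)%N by rewrite card_unit.
have := Lag_slope_le torus_gt0 k0 eta0 Heta.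
by rewrite card_unit mul1r leNgt L_large.
Qed.

(** The upper bound holds for every mu above lambda, and mu tends to lambda; for infinite lambda it
    is trivial. *)
Lemma Lag_slope_formula :
  ((M%:R ^+ 2 - 2)%:E < Lag_slope (surf R torus) alpha)%E ->
  Lag_slope (surf R O) alpha = (N%:E * lambda)%E.
Proof.
move=> L_large; apply/eqP; rewrite eq_le Lag_slope_lower andbT.
have N0 : 0 < N by rewrite ltr0n.
have upper mu : (lambda < mu%:E)%E ->
    (Lag_slope (surf R O) alpha <= (N * mu)%:E)%E.
  move=> lmu; have mu0 : 0 < mu by rewrite -lte_fin (le_lt_trans lambda_ge0).
  have [n0 H] := lambda_lt_ratio lmu.
  apply: Lag_slope_upper H _ => //; exact: lambda_large.
move: lambda_ge0 upper; case: lambda => [l| |]//= l0 upper; last first.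
  by rewrite gt0_muley ?lte_fin// leey.
apply/lee_addgt0Pr => e e0; rewrite -EFinM -EFinD.
have -> : N * l + e = N * (l + e / N) by rewrite mulrDr mulrCA mulfV ?mulr1 ?gt_eqF.
by apply: upper; rewrite lte_fin ltrDl divr_gt0.
Qed.

End Formula.

Theorem theorem2p9 (R : realType) (S : origami) (a : nat -> nat) (alpha : R)
    (S_prim : primitive R S)
    (a_gt0 : forall n, (0 < n)%N -> (0 < a n)%N)
    (alpha_cf : alpha = cf_inf (fun k => a k.+1))
    (alpha01 : 0 < alpha < 1)
    (alpha_irr : irrational alpha)
    (L_large : (((max_mult R S)%:R ^+ 2 - 2)%:E
                < Lag_slope (surf R torus) alpha)%E) :
  Lag_slope (surf R S) alpha =
  (#|sq S|%:R%:E *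
   limn_esup (fun n =>
     (\big[Num.max/0]_(1 <= i < (a n).+1)
        (cf_D a n i /
         (mult_infty
            (gl_act (mxR *m cf_g (rcons [seq a k | k <- iota 1 n.-1] i))
                 (surf R S)))%:R ^+ 2))%:E))%E.
Proof.
have [x x_sing] := primitive_singular S_prim.
have /andP[_ alpha_lt1] := alpha01.
exact: Lag_slope_formula x_sing L_large.
Qed.
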